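(* Let $W, W_1, W_2, \ldots$ be independent identically distributed random variables with $W>0$, and for each $n\ge 1$ let $E_n$ be the total number of edges of the generalized random graph on the vertex set $\{1,\dots,n\}$ with random vertex weights $W_1,\dots,W_n$. If $\mathbb{E} W^2<\infty$, then $$\frac{2E_n-n\,\mathbb{E} W}{\sqrt{n\,\bigl(2\,\mathbb{E} W+\operatorname{Var}(W)\bigr)}}\stackrel{d}{\longrightarrow} N(0,1)\qquad\text{as } n\to\infty.$$
   Context: Generalized random graph with vertex weights $W_1,\dots,W_n$: the vertex set is $\{1,\dots,n\}$ and there are no self-loops. Let $L_n=\sum_{i=1}^n W_i$ be the total weight. Conditionally on $W_1,\dots,W_n$, the edges between distinct pairs of vertices $1\le i<j\le n$ occur independently, the edge between $i$ and $j$ being present with probability $$p_{ij}=\frac{W_iW_j}{L_n+W_iW_j}.$$ Writing $I_{ij}$ for the indicator that the edge between $i$ and $j$ is present, the total number of edges is $E_n=\sum_{1\le i<j\le n} I_{ij}$. Here $\stackrel{d}{\longrightarrow}$ denotes convergence in distribution, and $N(0,1)$ is the standard normal distribution. *)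

(* Defs.v *)
From HB Require Import structures.
From mathcomp Require Import all_boot all_order all_algebra.
From mathcomp Require Import finmap.
From mathcomp Require Import all_classical all_reals all_analysis.

Set Implicit Arguments.
Unset Strict Implicit.
Unset Printing Implicit Defensive.

Import Order.TTheory GRing.Theory Num.Theory.
Import numFieldNormedType.Exports.

Local Open Scope classical_set_scope.
Local Open Scope ring_scope.

Section independence.
Context d (T : measurableType d) (R : realType) (P : probability T R).

Definition mutually_independent (I : choiceType) (X : I -> {RV P >-> R}) :=
  forall (J : {fset I}) (B : I -> set R),
    (forall i, i \in J -> measurable (B i)) ->
    P (\bigcap_(i in [set` J]) (X i @^-1` B i)) =
      (\prod_(i <- J) P (X i @^-1` B i))%E.

Definition identically_distributed (X Y : {RV P >-> R}) :=
  forall B : set R, measurable B -> distribution P X B = distribution P Y B.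

Definition iid (I : choiceType) (X : I -> {RV P >-> R}) :=
  mutually_independent X /\ forall i j, identically_distributed (X i) (X j).

End independence.

Section conditioning.
Context d (T : measurableType d) (R : realType) (P : probability T R).

(* Y is a version of the conditional probability P(A | G), for a
   sub-sigma-algebra G of the events. *)
Record is_cond_prob (G : set (set T)) (A : set T) (Y : T -> R) : Prop := {
  cond_prob_measurable :
    forall B : set R, measurable B -> G (Y @^-1` B) ;
  cond_prob_integrable : P.-integrable setT (EFin \o Y) ;
  cond_prob_integral : forall B, G B ->
    (\int[P]_(w in B) (Y w)%:E = P (A `&` B))%E }.

(* P(\bigcap_(k in S) A k | G) = \prod_(k in S) P(A k | G) almost surely, for
   every set S of indices; the choice of versions Y k is immaterial. *)
Definition cond_independent (G : set (set T)) (K : finType) (A : K -> set T) :=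
  forall (S : {set K}) (Y : K -> T -> R),
    (forall k, k \in S -> is_cond_prob G (A k) (Y k)) ->
    is_cond_prob G (\bigcap_(k in [set` S]) A k)
      (fun w => \prod_(k in S) Y k w).

End conditioning.

(* Convergence of the distribution functions of the random variables X n at
   every continuity point of the distribution function of mu. *)
Definition cvg_in_distribution d (T : measurableType d) (R : realType)
    (P : probability T R) (X : nat -> T -> R)
    (mu : probability (measurableTypeR R) R) :=
  (forall n, measurable_fun setT (X n)) /\
  forall x : R, {for x, continuous (fun y : R => mu [set` `]-oo, y]])} ->
    P (X n @^-1` [set` `]-oo, x]]) @[n --> \oo] --> mu [set` `]-oo, x]].

(* Pairs i < j of vertices. Vertices are numbered from 0, so that i : 'I_n
   stands for vertex i.+1 of {1, ..., n} and carries the weight W i.+1; the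
   variable W 0 is the generic copy of the weights and is not used by any
   vertex. *)
Notation vertex_pair n := {e : 'I_n * 'I_n | (e.1 < e.2)%N}.

Section generalized_random_graph.
Context d (T : measurableType d) (R : realType) (P : probability T R).
Variables (W : nat -> {RV P >-> R}) (n : nat).

Definition vertex_weight (i : 'I_n) : {RV P >-> R} := W i.+1.

Definition total_weight (w : T) : R := \sum_(i < n) vertex_weight i w.

Definition edge_prob (e : vertex_pair n) (w : T) : R :=
  let wi := vertex_weight (val e).1 w in
  let wj := vertex_weight (val e).2 w in
  wi * wj / (total_weight w + wi * wj).

Definition weight_sigma_algebra : set (set T) :=
  g_sigma_preimage (fun i : 'I_n => vertex_weight i : T -> R).

(* I e w is true iff the edge e is present. *)
Record is_generalized_random_graph (I : vertex_pair n -> {RV P >-> bool}) :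
    Prop := {
  grg_edge_prob : forall e,
    is_cond_prob P weight_sigma_algebra (I e @^-1` [set true]) (edge_prob e) ;
  grg_edges_independent :
    cond_independent P weight_sigma_algebra
      (fun e => I e @^-1` [set true]) }.

Definition edge_count (I : vertex_pair n -> {RV P >-> bool}) (w : T) : nat :=
  (\sum_(e : vertex_pair n) I e w)%N.

End generalized_random_graph.

(* Main.v *)
Require Import Defs.
From mathcomp Require Import all_boot all_order all_algebra.
From mathcomp Require Import finmap.
From mathcomp Require Import all_classical all_reals all_analysis.
From mathcomp Require Import measurable_realfun ring lra.

(* The heat function heat m s x = Phi ((m - x) / sqrt s), Phi the normal
   distribution function, satisfies d/ds = 1/2 d^2/dx^2, so replacing x by
   x + xi with xi centered of variance t amounts, in mean and up to third order
   terms, to replacing s by s + t. This gives Lindeberg's exchange argument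
   without auxiliary Gaussian variables, and since heat m s tends to the
   indicator of ]-oo, m] as s tends to 0, convergence of E (heat m s (X_n)) to
   heat m (s + 1) 0 for all m and s > 0 implies X_n -> N(0,1).

   The exchange is done twice, with a = 1 / sqrt (n (2 mu + var)). Given the
   weights, 2 a E_n is centered at 2 a sum p_ij with variance
   4 a^2 sum p_ij (1 - p_ij), and the edges are exchanged one by one. With
   L = sum W_i and Q = sum W_i^2,
     0 <= L - 2 sum p_ij <= Q / L + (Q / L)^2  and  2 sum p_ij^2 <= (Q / L)^2,
   where Q / L is bounded in probability, so the result is close to
   heat m (s + 2 mu / (2 mu + var)) (a (L - n mu)). The sum L - n mu of
   independent centered variables is then exchanged in turn, which adds the
   missing var / (2 mu + var). *)

Set Implicit Arguments.
Unset Strict Implicit.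
Unset Printing Implicit Defensive.

Import Order.TTheory GRing.Theory Num.Theory.
Import numFieldNormedType.Exports.

Local Open Scope classical_set_scope.
Local Open Scope ring_scope.

(** * Calculus *)

Section derivatives.
Context {R : realType}.
Implicit Types (f g : R -> R) (x : R).

(** Conditioning is available only through versions of the conditional probabilities of events, so
    no conditional law of E_n is built. An identity of integrals replaces E F(E_n) by the mean of
    [poisson_binomial] at the random parameters [edge_prob]; the edge exchange is then a
    deterministic statement at fixed weights. There are of order n^2 edges and a is of order
    n^(-1/2), so an error of order a^3 per edge would be too large. Each exchange has to keep a
    factor p_ij: since 2 sum p_ij <= L, the total is then of order a^3 n, that is, a. For the
    weights only second moments exist, whence remainders h^2 min(1, |h|) instead of |h|^3. That Q /
    L is bounded in probability does not bound its mean. As heat functions take values in [0,1], an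
    error may be cut off at 1: where L < n mu / 2 this costs a Chebyshev term in (L - n mu)^2, and
    elsewhere L is replaced by n mu / 2. What remains is linear in L, (L - n mu)^2 and Q, whose
    means are explicit. *)

Lemma is_derive_mul f g x (df dg : R) : is_derive x 1 f df -> is_derive x 1 g dg ->
  is_derive x 1 (fun t => f t * g t) (df * g x + f x * dg).
Proof.
move=> hf hg; have := is_deriveM hf hg.
by rewrite /GRing.scale /= addrC [g x * df]mulrC.
Qed.

Lemma is_derive_add f g x (df dg : R) : is_derive x 1 f df -> is_derive x 1 g dg ->
  is_derive x 1 (fun t => f t + g t) (df + dg).
Proof. by move=> hf hg; exact: is_deriveD hf hg. Qed.

Lemma is_derive_inv f x (df : R) : f x != 0 -> is_derive x 1 f df ->
  is_derive x 1 (fun t => (f t)^-1) (- df / f x ^+ 2).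
Proof.
move=> fx hf; have := is_deriveV fx hf.
by rewrite /GRing.scale /= mulrC mulrN mulNr.
Qed.

Lemma is_derive_compose f g x (df dg : R) : is_derive (g x) 1 f df ->
  is_derive x 1 g dg -> is_derive x 1 (fun t => f (g t)) (df * dg).
Proof. by move=> hf hg; rewrite -/(f \o g); exact: is_derive1_comp. Qed.

Lemma is_derive_congr f g x (df dg : R) : is_derive x 1 f df ->
  f =1 g -> df = dg -> is_derive x 1 g dg.
Proof. by move=> + /funext <- <-. Qed.

(** The form with [Num.min] and [Num.max] covers increments of either sign; centered steps take
    both. *)
Lemma mean_value f (df : R -> R) a b :
    (forall x, Num.min a b <= x <= Num.max a b -> is_derive x 1 f (df x)) ->
  exists2 c, Num.min a b <= c <= Num.max a b & f b - f a = df c * (b - a).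
Proof.
wlog ab : a b / a <= b.
  move=> H D; have /orP[ab|ba] := le_total a b; first exact: H.
  have [|c cab e] := H b a ba; first by move=> x; rewrite minC maxC; exact: D.
  exists c; first by rewrite minC maxC.
  by rewrite -opprB e -mulrN opprB.
rewrite min_l// max_r// => D.
have [x||c] := @MVT_segment R f df a b ab.
- by rewrite in_itv/= => /andP[/ltW ? /ltW ?]; apply: D; apply/andP.
- apply: derivable_within_continuous => x; rewrite in_itv/= => xab.
  by case: (D x xab).
- by rewrite in_itv/= => cab e; exists c.
Qed.

Lemma taylor1 f (df : R -> R) (L a b : R) :
    (forall x, Num.min a b <= x <= Num.max a b -> is_derive x 1 f (df x)) ->
    (forall x, Num.min a b <= x <= Num.max a b ->
       `|df x - df a| <= L * `|x - a|) ->
  `|f b - f a - (b - a) * df a| <= L * (b - a) ^+ 2.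
Proof.
move=> D Lip.
have [->|ba] := eqVneq b a; first by rewrite !subrr mul0r subrr normr0 expr0n mulr0.
have bab : Num.min a b <= b <= Num.max a b by rewrite ge_min le_max lexx !orbT.
have [c cab e] := mean_value D.
have L0 : `|c - a| <= `|b - a|.
  have /orP[ab|ab] := le_total a b;
    rewrite ?(min_l ab, max_r ab, min_r ab, max_l ab) in cab; case/andP: cab => ? ?.
    by rewrite !ger0_norm; lra.
  by rewrite !ler0_norm; lra.
have L1 := Lip _ cab.
have -> : f b - f a - (b - a) * df a = (df c - df a) * (b - a) by rewrite e; ring.
rewrite normrM -[(b - a) ^+ 2]ger0_norm ?sqr_ge0// normrX expr2.
apply: (le_trans (ler_wpM2r (normr_ge0 _) L1)).
rewrite mulrA ler_wpM2r// ler_wpM2l//.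
(* Nonnegativity of [L] is read off from the Lipschitz bound at [b], where [|b - a| > 0]. *)
have := Lip b bab; move=> /(le_trans (normr_ge0 _)).
by rewrite pmulr_lge0// normr_gt0 subr_eq0.
Qed.

End derivatives.

(** * The standard normal density and distribution function *)

Section gaussian.
Context {R : realType}.
Implicit Types x y z h s : R.

Definition gauss_density x : R := normal_pdf 0 1 x.

Definition gauss_cdf x : R := fine (normal_prob 0 1 `]-oo, x]).

Lemma gauss_densityE x : gauss_density x = normal_peak 1 * expR (- (x ^+ 2 / 2)).
Proof.
rewrite /gauss_density normal_pdfE ?oner_eq0// /normal_fun subr0 expr1n.
by rewrite mulNr.
Qed.

Lemma gauss_density_ge0 x : 0 <= gauss_density x.
Proof. exact: normal_pdf_ge0. Qed.

(** The peak is at most 1, exp(x^2 / 2) = exp(x^2 / 4)^2 >= (1 + x^2 / 4)^2, and 16 (1 + x^2 / 4)^2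
    >= (1 + x^2)^2. The weight of degree 4 absorbs every polynomial factor, of degree at most 3,
    that the derivatives of [heat] produce. *)
Lemma gauss_density_bound x : gauss_density x * (1 + x ^+ 2) ^+ 2 <= 16.
Proof.
have peak1 : normal_peak (1 : R) <= 1.
  have pi2 := @pi_ge2 R.
  rewrite /normal_peak expr1n mul1r mulr2n invf_le1 ?sqrtr_gt0; last by lra.
  by rewrite -[leLHS]sqrtr1 ler_sqrt; lra.
have e1 : 1 + x ^+ 2 / 4 <= expR (x ^+ 2 / 4) by exact: expR_ge1Dx.
have e2 : (1 + x ^+ 2 / 4) ^+ 2 <= expR (x ^+ 2 / 2).
  have -> : x ^+ 2 / 2 = x ^+ 2 / 4 + x ^+ 2 / 4 by field.
  by rewrite expRD expr2 ler_pM// addr_ge0// divr_ge0// sqr_ge0.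
rewrite gauss_densityE expRN -mulrA.
rewrite -[leRHS]mul1r ler_pM ?normal_peak_ge0//.
  by rewrite mulr_ge0 ?invr_ge0 ?expR_ge0 ?sqr_ge0.
rewrite mulrC ler_pdivrMr ?expR_gt0//.
apply: le_trans (ler_wpM2l _ e2) => //.
have := sqr_ge0 x; nra.
Qed.

Lemma is_derive_gauss_density x :
  is_derive x 1 gauss_density (- x * gauss_density x).
Proof.
have -> : gauss_density = fun t => normal_peak 1 * expR (- (t * t) * 2^-1).
  by apply/funext => t; rewrite gauss_densityE -mulNr.
have d2 : is_derive x 1 (fun t : R => - (t * t) * 2^-1) (- x).
  have := is_derive_mul (is_deriveN (is_derive_mul (is_derive_id x 1)
    (is_derive_id x 1))) (is_derive_cst (2^-1 : R) x 1).
  move/is_derive_congr; apply; first by [].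
  by rewrite /cst /=; field.
have := is_derive_mul (is_derive_cst (normal_peak 1 : R) x 1)
  (is_derive_compose (is_derive_expR _) d2).
move/is_derive_congr; apply; first by [].
by rewrite /cst /=; ring.
Qed.

Lemma is_derive_gauss_cdf x : is_derive x 1 gauss_cdf (gauss_density x).
Proof.
have [] := @continuous_FTC1 R gauss_density -oo%O x (x + 1).
- by rewrite ltrDl.
- apply: (@integrableS _ _ _ _ setT) => //.
  exact: integrable_normal_pdf.
- by rewrite ltNyr.
- exact: continuous_normal_pdf.
move=> /derivableP D; rewrite derive1E => e.
by rewrite -e; exact: D.
Qed.

End gaussian.

Section gaussian_bounds.
Context {R : realType}.
Implicit Types x y z h s : R.

Lemma gauss_cdf_ge0 x : 0 <= gauss_cdf x.
Proof. exact: fine_ge0. Qed.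

Lemma EFin_gauss_cdf x : (gauss_cdf x)%:E = normal_prob 0 1 `]-oo, x].
Proof. by rewrite fineK// fin_num_measure. Qed.

Lemma gauss_cdf_le1 x : gauss_cdf x <= 1.
Proof. by rewrite -lee_fin EFin_gauss_cdf probability_le1. Qed.

Lemma gauss_cdf_homo x y : x <= y -> gauss_cdf x <= gauss_cdf y.
Proof.
move=> xy; rewrite -lee_fin !EFin_gauss_cdf le_measure ?inE//.
exact: subitvPr.
Qed.

Lemma continuous_gauss_cdf : continuous (@gauss_cdf R).
Proof.
move=> x; have [+ _] := is_derive_gauss_cdf x.
by move=> /derivable1_diffP/differentiable_continuous H; exact: H.
Qed.

Lemma gauss_cdf_tails (e : R) : 0 < e ->
  exists2 K : R, 0 < K & gauss_cdf (- K) <= e /\ 1 - gauss_cdf K <= e.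
Proof.
move=> e0.
have mi : @measurable_fun _ _ (measurableTypeR R) R setT idfun.
  by move=> _ Y mY; rewrite setTI; exact: mY.
(* The identity on the normal probability space is a random variable with distribution function
   [gauss_cdf], so the limits of [cdf] at both infinities apply. *)
pose X : {RV (@normal_prob R 0 1) >-> R} := @mfun_Sub _ _ (measurableTypeR R) R idfun (mem_set mi).
have cdfE r : cdf X r = (gauss_cdf r)%:E by rewrite EFin_gauss_cdf.
have := @cvg_cdfy1 _ _ _ _ X.
have := @cvg_cdfNy0 _ _ _ _ X.
have -> : cdf X = EFin \o gauss_cdf by apply/funext.
move=> /fine_cvgP[_ /cvgrPdist_le/(_ _ e0) N0].
move=> /fine_cvgP[_ /cvgrPdist_le/(_ _ e0) P1].
have [K [K0 [NK PK]]] : exists K, 0 < K /\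
    (`|0 - gauss_cdf (- K)| <= e /\ `|1 - gauss_cdf K| <= e).
  move: N0 P1 => [a [ar Ha]] [b [br Hb]].
  pose K := Num.max 1 (Num.max (1 - a) (b + 1)).
  have aK : 1 - a <= K by rewrite !le_max lexx orbT.
  have bK : b + 1 <= K by rewrite !le_max lexx !orbT.
  exists K; split; first by rewrite lt_max ltr01.
  by split; [apply: Ha; lra|apply: Hb; lra].
exists K => //; split.
  by move: NK; rewrite sub0r normrN ger0_norm// gauss_cdf_ge0.
by move: PK; rewrite ger0_norm// subr_ge0 gauss_cdf_le1.
Qed.

(** The first and second derivatives of [gauss_density]. *)
Let phi1 z : R := - z * gauss_density z.
Let phi2 z : R := (z ^+ 2 - 1) * gauss_density z.

Lemma gauss_density_mul_le z (c : R) : `|c| <= (1 + z ^+ 2) ^+ 2 ->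
  `|c * gauss_density z| <= 16.
Proof.
move=> cz; rewrite normrM (ger0_norm (gauss_density_ge0 z)) mulrC.
by apply: le_trans (gauss_density_bound z); rewrite ler_wpM2l// gauss_density_ge0.
Qed.

Let phi_le z : `|gauss_density z| <= 16.
Proof.
rewrite -[X in `|X|]mul1r; apply: gauss_density_mul_le; rewrite normr1.
by rewrite exprn_ege1// lerDl sqr_ge0.
Qed.

Let abs_le z : `|z| <= 1 + z ^+ 2.
Proof. by rewrite -real_normK ?num_real//; have := normr_ge0 z; nra. Qed.

Let le_sq (y : R) : 1 <= y -> y <= y ^+ 2.
Proof. by move=> ?; rewrite expr2 ler_peMl// (le_trans ler01). Qed.

Let one_le z : 1 <= 1 + z ^+ 2. Proof. by rewrite lerDl sqr_ge0. Qed.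

Let phi1_le z : `|phi1 z| <= 16.
Proof.
apply: gauss_density_mul_le; rewrite normrN (le_trans (abs_le z))//.
exact: le_sq.
Qed.

Let sqB1_le z : `|z ^+ 2 - 1| <= 1 + z ^+ 2.
Proof. by rewrite ler_norml; have := sqr_ge0 z; lra. Qed.

Let phi2_le z : `|phi2 z| <= 16.
Proof.
apply: gauss_density_mul_le; rewrite (le_trans (sqB1_le z))//.
exact: le_sq.
Qed.

Let zphi2_le z : `|z * phi2 z| <= 16.
Proof.
rewrite /phi2 mulrA; apply: gauss_density_mul_le.
by rewrite normrM [leRHS]expr2 ler_pM// ?abs_le ?sqB1_le.
Qed.

Let is_derive_phi1 z : is_derive z 1 phi1 (phi2 z).
Proof.
have := is_derive_mul (is_deriveN (is_derive_id z 1)) (is_derive_gauss_density z).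
move/is_derive_congr; apply; first by [].
by rewrite /phi2 !fctE /=; ring.
Qed.

Let phi_lip x y : `|gauss_density y - gauss_density x| <= 16 * `|y - x|.
Proof.
have [c _ ->] := mean_value (fun z _ => is_derive_gauss_density z) (a := x) (b := y).
by rewrite normrM ler_wpM2r// phi1_le.
Qed.

Let phi1_lip x y : `|phi1 y - phi1 x| <= 16 * `|y - x|.
Proof.
have [c _ ->] := mean_value (fun z _ => is_derive_phi1 z) (a := x) (b := y).
by rewrite normrM ler_wpM2r// phi2_le.
Qed.

Lemma gauss_cdf_lip x y : `|gauss_cdf y - gauss_cdf x| <= 16 * `|y - x|.
Proof.
have [c _ ->] := mean_value (fun z _ => is_derive_gauss_cdf z) (a := x) (b := y).
by rewrite normrM ler_wpM2r// phi_le.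
Qed.

(** The remainder [r] vanishes at 0 and its derivative phi(z + t) - phi(z) - t phi'(z) is at most 32
    |t| and at most 16 t^2, by the Lipschitz bounds on phi and on phi'. The mean value theorem adds
    a factor |h|. The bound of order h^2 serves variables without a third moment. *)
Lemma gauss_cdf_taylor z h :
  `|gauss_cdf (z + h) - gauss_cdf z - h * gauss_density z -
    h ^+ 2 * (- z * gauss_density z / 2)| <= 32 * (h ^+ 2 * Num.min 1 `|h|).
Proof.
pose r t := gauss_cdf (z + t) - gauss_cdf z - t * gauss_density z - t ^+ 2 * (phi1 z / 2).
have dr (t : R) : is_derive t 1 r (gauss_density (z + t) - gauss_density z - t * phi1 z).
  have d1 : is_derive t 1 (fun t => z + t) (1 : R).
    have := is_derive_add (is_derive_cst z t 1) (is_derive_id t 1).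
    by move/is_derive_congr; apply => //; rewrite add0r.
  have d2 := is_derive_compose (is_derive_gauss_cdf (z + t)) d1.
  have d3 := is_derive_mul (is_derive_id t 1) (is_derive_cst (- gauss_density z) t 1).
  have d4 := is_derive_mul (is_derive_mul (is_derive_id t 1) (is_derive_id t 1))
    (is_derive_cst (- phi1 z / 2) t 1).
  have d5 := is_derive_add
    (is_derive_add d2 (is_derive_cst (- gauss_cdf z) t 1)) (is_derive_add d3 d4).
  apply: is_derive_congr d5 _ _; first by move=> u; rewrite /r /cst/=; ring.
  by rewrite /cst/=; field.
have [c ch e] := mean_value (fun t _ => dr t) (a := 0) (b := h).
have ch' : `|c| <= `|h|.
  have /orP[h0|h0] := le_total 0 h;
    rewrite ?(min_l h0, max_r h0, min_r h0, max_l h0) in ch;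
    case/andP: ch => ? ?; first by rewrite !ger0_norm; lra.
  by rewrite !ler0_norm; lra.
have -> : gauss_cdf (z + h) - gauss_cdf z - h * gauss_density z -
    h ^+ 2 * (- z * gauss_density z / 2) = r h - r 0.
  by rewrite /r addr0 /phi1; ring.
have nh : h ^+ 2 = `|h| * `|h| by rewrite -expr2 real_normK// num_real.
rewrite e subr0 normrM nh.
set D := `|_ - _ - _|; suff : D <= 32 * (`|h| * Num.min 1 `|h|).
  move=> H; apply: le_trans (ler_wpM2r (normr_ge0 h) H) _.
  by rewrite le_eqVlt; apply/predU1P; left; ring.
have b1 : D <= 32 * `|h|.
  apply: le_trans (ler_normB _ _) _.
  have := phi_lip z (z + c); rewrite addrAC subrr add0r => H1.
  have H2 : `|c * phi1 z| <= `|c| * 16 by rewrite normrM ler_wpM2l.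
  by have := normr_ge0 c; lra.
have b2 : D <= 16 * `|h| ^+ 2.
  have := @taylor1 R gauss_density phi1 16 z (z + c)
    (fun x _ => is_derive_gauss_density x) (fun x _ => phi1_lip z x).
  rewrite [z + c - z]addrAC subrr add0r => /le_trans; apply.
  rewrite -[c ^+ 2]real_normK ?num_real//.
  by rewrite ler_wpM2l// lerXn2r// nnegrE.
have [?|?] := leP 1 `|h|; first by rewrite mulr1.
by apply: (le_trans b2); rewrite expr2; have := normr_ge0 h; nra.
Qed.

(** * Heat functions, with bounds uniform over times bounded away from zero *)

Definition heat m s x : R := gauss_cdf ((m - x) / Num.sqrt s).

Definition heat_dx m s x : R :=
  - gauss_density ((m - x) / Num.sqrt s) / Num.sqrt s.

(* By the heat equation, this is also half the second derivative in x. *)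
Definition heat_ds m s x : R :=
  let z := (m - x) / Num.sqrt s in - z * gauss_density z / (2 * s).

Variables (m k : R).
Hypothesis k0 : 0 < k.

(** One constant for all bounds at times [s >= k]: 32 comes from the Taylor bound, and since 1 / s
    <= 1 / k and 1 / sqrt s <= 1 + 1 / k, the powers of 1 / s that occur are at most (1 + 1 /
    k)^2. *)
Definition heat_const : R := 32 * (1 + k^-1) ^+ 2.

Let u0 : 0 < k^-1. Proof. by rewrite invr_gt0. Qed.

Let sV_le s : k <= s -> s^-1 <= k^-1.
Proof. by move=> ks; rewrite lef_pV2// posrE (lt_le_trans k0). Qed.

Let sqrtV_le s : k <= s -> (Num.sqrt s)^-1 <= 1 + k^-1.
Proof.
move=> ks; have s0 := lt_le_trans k0 ks.
have := sV_le ks.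
have -> : s^-1 = (Num.sqrt s)^-1 ^+ 2 by rewrite exprVn sqr_sqrtr// ltW.
have : 0 < (Num.sqrt s)^-1 by rewrite invr_gt0 sqrtr_gt0.
by set v := _^-1; nra.
Qed.

Lemma heat_ge0 s x : 0 <= heat m s x. Proof. exact: gauss_cdf_ge0. Qed.

Lemma heat_le1 s x : heat m s x <= 1. Proof. exact: gauss_cdf_le1. Qed.

Lemma heat_const_ge1 : 1 <= heat_const.
Proof. by rewrite /heat_const; have := u0; nra. Qed.

Lemma heat_dx_le s x : k <= s -> `|heat_dx m s x| <= heat_const.
Proof.
move=> ks; have s0 := lt_le_trans k0 ks.
rewrite normrM normrN normfV (ger0_norm (sqrtr_ge0 s)).
apply: (@le_trans _ _ (16 * (1 + k^-1))).
  by rewrite ler_pM ?invr_ge0 ?sqrtr_ge0 ?phi_le ?sqrtV_le.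
by rewrite /heat_const; have := u0; nra.
Qed.

Lemma heat_ds_le s x : k <= s -> `|heat_ds m s x| <= heat_const.
Proof.
move=> ks; have s0 := lt_le_trans k0 ks.
rewrite /heat_ds normrM normfV (@ger0_norm _ (2 * s)); last by lra.
apply: (@le_trans _ _ (16 * k^-1)); last by rewrite /heat_const; have := u0; nra.
rewrite ler_pM ?invr_ge0 ?phi1_le//; first by lra.
by apply: le_trans (sV_le ks); rewrite lef_pV2 ?posrE; lra.
Qed.

Lemma heat_taylor_space s x h : k <= s ->
  `|heat m s (x + h) - heat m s x - h * heat_dx m s x - h ^+ 2 * heat_ds m s x|
    <= heat_const * (h ^+ 2 * Num.min 1 `|h|).
Proof.
move=> ks; have s0 := lt_le_trans k0 ks.
have q0 : 0 < Num.sqrt s by rewrite sqrtr_gt0.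
set z := (m - x) / Num.sqrt s; set e := - h / Num.sqrt s.
have := gauss_cdf_taylor z e.
have -> : z + e = (m - (x + h)) / Num.sqrt s by rewrite /z /e; field; rewrite gt_eqF.
have <- : h * heat_dx m s x = e * gauss_density z.
  by rewrite /heat_dx /e -/z; ring.
have e2 : e ^+ 2 = h ^+ 2 / s.
  by rewrite /e exprMn sqrrN exprVn sqr_sqrtr// ltW.
have <- : h ^+ 2 * heat_ds m s x = e ^+ 2 * (- z * gauss_density z / 2).
  by rewrite /heat_ds e2 -/z; field; rewrite gt_eqF.
move=> /le_trans; apply.
have ea : `|e| <= (1 + k^-1) * `|h|.
  rewrite /e normrM normrN mulrC ler_wpM2r// ger0_norm ?invr_ge0 ?(ltW q0)//.
  exact: sqrtV_le.
have eb : Num.min 1 `|e| <= (1 + k^-1) * Num.min 1 `|h|.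
  have uu := u0; have [h1|h1] := leP 1 `|h|.
    by rewrite (@le_trans _ _ 1)// ?ge_min ?lexx// mulr1; lra.
  by rewrite (le_trans _ ea)// ge_min lexx orbT.
rewrite /heat_const -[leRHS]mulrA; apply: ler_wpM2l => //; rewrite e2.
have h2 := sqr_ge0 h.
have sk := sV_le ks.
have sV0 : 0 <= s^-1 by rewrite invr_ge0 ltW.
have m0 : 0 <= Num.min 1 `|e| by rewrite le_min ler01 normr_ge0.
have m1 : 0 <= Num.min 1 `|h| by rewrite le_min ler01 normr_ge0.
have -> : (1 + k^-1) ^+ 2 * (h ^+ 2 * Num.min 1 `|h|) =
  (h ^+ 2 * (1 + k^-1)) * ((1 + k^-1) * Num.min 1 `|h|) by ring.
apply: ler_pM => //; first by rewrite mulr_ge0.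
by rewrite ler_wpM2l//; lra.
Qed.

Let is_derive_scale y s : 0 < s ->
  is_derive s 1 (fun t : R => y / Num.sqrt t) (- (y / Num.sqrt s) / (2 * s)).
Proof.
move=> s0; have q0 : 0 < Num.sqrt s by rewrite sqrtr_gt0.
have q1 : Num.sqrt s != 0 by rewrite gt_eqF.
have d1 := is_derive_inv q1 (is_derive1_sqrt s0).
have := is_derive_mul (is_derive_cst y s 1) d1.
move/is_derive_congr; apply; first by [].
have -> : 2 * s = 2 * Num.sqrt s ^+ 2 by rewrite sqr_sqrtr// ltW.
by rewrite /cst; field.
Qed.

Let is_derive_heat_ds x s : 0 < s -> is_derive s 1 (fun t => heat m t x) (heat_ds m s x).
Proof.
move=> s0.
have := is_derive_compose (is_derive_gauss_cdf _) (is_derive_scale (m - x) s0).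
move/is_derive_congr; apply; first by [].
by rewrite /heat_ds; ring.
Qed.

(** The second time derivative of [heat]; its term [z * phi2 z] contains the polynomial of highest
    degree, 3. *)
Let heat_dss x s : R := let z := (m - x) / Num.sqrt s in
  - (z * phi2 z) / (4 * s ^+ 2) - phi1 z / (2 * s ^+ 2).

Let is_derive_heat_dss x s : 0 < s ->
  is_derive s 1 (fun t => heat_ds m t x) (heat_dss x s).
Proof.
move=> s0.
have d1 := is_derive_compose (is_derive_phi1 _) (is_derive_scale (m - x) s0).
have d2 := is_derive_mul (is_derive_cst (2 : R) s 1) (is_derive_id s 1).
have s20 : cst (2 : R) s * id s != 0 by rewrite /cst /= mulf_neq0// gt_eqF.
have := is_derive_mul d1 (is_derive_inv s20 d2).
move/is_derive_congr; apply; first by [].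
by rewrite /heat_dss /cst /=; set z := (m - x) / _; field; rewrite gt_eqF.
Qed.

Let heat_dss_le x s : k <= s -> `|heat_dss x s| <= heat_const.
Proof.
move=> ks; have s0 := lt_le_trans k0 ks.
have sk := sV_le ks.
have sV0 : 0 < s^-1 by rewrite invr_gt0.
rewrite /heat_dss; set z := (m - x) / _.
have -> : - (z * phi2 z) / (4 * s ^+ 2) - phi1 z / (2 * s ^+ 2) =
   s^-1 ^+ 2 * (- (z * phi2 z) / 4 - phi1 z / 2) by field; rewrite gt_eqF.
rewrite normrM (@ger0_norm _ (s^-1 ^+ 2)) ?sqr_ge0//.
apply: (@le_trans _ _ ((1 + k^-1) ^+ 2 * 32)); last by rewrite /heat_const mulrC.
rewrite ler_pM ?sqr_ge0//.
  by rewrite lerXn2r ?nnegrE; lra.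
have := zphi2_le z; have := phi1_le z; rewrite !ler_norml => /andP[? ?] /andP[? ?].
by apply/andP; split; lra.
Qed.

Lemma heat_taylor_time s (t : R) x : k <= s -> 0 <= t ->
  `|heat m (s + t) x - heat m s x - t * heat_ds m s x| <= heat_const * t ^+ 2.
Proof.
move=> ks t0.
have sst : s <= s + t by rewrite lerDl.
have rg y : Num.min s (s + t) <= y <= Num.max s (s + t) -> k <= y.
  by rewrite min_l// => /andP[+ _]; exact: le_trans.
have := @taylor1 R (fun y => heat m y x) (fun y => heat_ds m y x) heat_const s (s + t).
rewrite [s + t - s]addrAC subrr add0r; apply.
  by move=> y /rg ky; apply: is_derive_heat_ds; exact: lt_le_trans ky.
move=> y yst.
have rg' z : Num.min s y <= z <= Num.max s y -> k <= z.
  move: yst; rewrite min_l// max_r// => /andP[sy _].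
  by rewrite min_l// => /andP[+ _]; exact: le_trans.
have [z zsy|c csy ->] := @mean_value R (fun y => heat_ds m y x) (heat_dss x) s y.
  by apply: is_derive_heat_dss; apply: lt_le_trans k0 _; exact: rg'.
by rewrite normrM ler_wpM2r// heat_dss_le// rg'.
Qed.

Lemma heat_lip s s' x x' : k <= s -> k <= s' ->
  `|heat m s x - heat m s' x'| <= heat_const * (`|s - s'| + `|x - x'|).
Proof.
move=> ks ks'; have s0 := lt_le_trans k0 ks.
have e1 : `|heat m s x - heat m s x'| <= heat_const * `|x - x'|.
  apply: le_trans (gauss_cdf_lip _ _) _.
  rewrite -mulrBl normrM normfV (ger0_norm (sqrtr_ge0 s)).
  have -> : m - x - (m - x') = - (x - x') by ring.
  rewrite normrN mulrCA mulrC; rewrite ler_wpM2r//.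
  have := sqrtV_le ks; have := u0; rewrite /heat_const; nra.
have e2 : `|heat m s x' - heat m s' x'| <= heat_const * `|s - s'|.
  have [c /andP[+ _]|c cs ->] :=
      @mean_value R (fun y => heat m y x') (fun y => heat_ds m y x') s' s.
    rewrite ge_min => H; apply: is_derive_heat_ds.
    by apply: lt_le_trans k0 _; case/orP: H; exact: le_trans.
  rewrite normrM ler_wpM2r// heat_ds_le//.
  by move: cs => /andP[+ _]; rewrite ge_min => /orP[];
    [exact: le_trans ks'|exact: le_trans ks].
rewrite mulrDr [leRHS]addrC.
by apply: le_trans (ler_distD (heat m s x') _ _) _; rewrite lerD.
Qed.

Lemma continuous_heat_arg s : continuous (fun x => (m - x) / Num.sqrt s).
Proof.
move=> x; apply: cvgM; last exact: cvg_cst.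
by apply: cvgB; [exact: cvg_cst|exact: cvg_id].
Qed.

Lemma measurable_heat s : measurable_fun setT (heat m s).
Proof.
apply: continuous_measurable_fun => x.
apply: (@continuous_comp _ _ _ (fun x => (m - x) / Num.sqrt s) gauss_cdf).
  exact: continuous_heat_arg.
exact: continuous_gauss_cdf.
Qed.

Let measurable_density_arg s :
  measurable_fun setT (fun x => gauss_density ((m - x) / Num.sqrt s)).
Proof.
apply: continuous_measurable_fun => x.
apply: (@continuous_comp _ _ _ (fun x => (m - x) / Num.sqrt s) gauss_density).
  exact: continuous_heat_arg.
by apply: continuous_normal_pdf; rewrite oner_eq0.
Qed.

Lemma measurable_heat_dx s : measurable_fun setT (heat_dx m s).
Proof.
by apply: measurable_funM => //; exact: measurable_funN.
Qed.

Lemma measurable_heat_ds s : measurable_fun setT (heat_ds m s).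
Proof.
apply: measurable_funM => //; apply: measurable_funM => //.
apply: measurable_funN; apply: continuous_measurable_fun.
exact: continuous_heat_arg.
Qed.

End gaussian_bounds.

(** * Sums of independent Bernoulli variables *)

Section poisson_binomial.
Context {R : realType}.
Implicit Types (ps : seq R) (K : nat -> R).

(* Expectation of K at the number of successes among independent trials with
   success probabilities ps. *)
Fixpoint poisson_binomial ps K : R :=
  if ps is p :: ps then
    p * poisson_binomial ps (fun j => K j.+1) + (1 - p) * poisson_binomial ps K
  else K 0%N.

Lemma eq_poisson_binomial ps K K' : K =1 K' ->
  poisson_binomial ps K = poisson_binomial ps K'.
Proof. by move=> /funext ->. Qed.

Variables (m k : R).
Hypothesis k0 : 0 < k.

(** The centered step is c (1 - p) with probability p and - c p otherwise. The first order terms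
    cancel, and the second order ones add up to the variance c^2 p (1 - p), which is the time
    increment. The factor p in the error is what makes the sum over all edges small. *)
Let bernoulli_step (s x c p : R) : k <= s -> 0 <= c <= 1 -> 0 <= p <= 1 ->
  `|p * heat m s (x + c * (1 - p)) + (1 - p) * heat m s (x - c * p) -
    heat m (s + c ^+ 2 * (p * (1 - p))) x| <= 3 * heat_const k * (c ^+ 3 * p).
Proof.
move=> ks /andP[c0 c1] /andP[p0 p1].
set q := 1 - p; have q0 : 0 <= q by rewrite /q; lra.
have q1 : q <= 1 by rewrite /q; lra.
have C0 : 0 <= heat_const k := le_trans ler01 (heat_const_ge1 k0).
have pq0 : 0 <= p * q by rewrite mulr_ge0.
have pq1 : p * q <= 1 by rewrite -[leRHS]mulr1 ler_pM.
have pqp : p * q <= p by rewrite ler_piMr.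
have c20 : 0 <= c ^+ 2 by rewrite exprn_ge0.
have c30 : 0 <= c ^+ 3 by rewrite exprn_ge0.
have cq0 : 0 <= c * q by rewrite mulr_ge0.
have cp0 : 0 <= c * p by rewrite mulr_ge0.
have H1 := heat_taylor_space m k0 x (c * q) ks.
have H2 := heat_taylor_space m k0 x (- (c * p)) ks.
have H3 := heat_taylor_time m k0 x ks (mulr_ge0 c20 pq0).
rewrite sqrrN normrN in H2.
rewrite (ger0_norm cq0) in H1; rewrite (ger0_norm cp0) in H2.
(* The factor p has three origins: in [b1] it is supplied later by the probability of success, in
   [b2] by the smallness of the step itself, in [b3] by the variance. *)
have b1 : (c * q) ^+ 2 * Num.min 1 (c * q) <= c ^+ 3.
  apply: (@le_trans _ _ ((c * q) ^+ 2 * (c * q))).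
    by rewrite ler_wpM2l ?sqr_ge0// ge_min lexx orbT.
  by rewrite -exprSr lerXn2r ?nnegrE// ler_piMr.
have b2 : (c * p) ^+ 2 * Num.min 1 (c * p) <= c ^+ 3 * p.
  apply: (@le_trans _ _ ((c * p) ^+ 2 * (c * p))).
    by rewrite ler_wpM2l ?sqr_ge0// ge_min lexx orbT.
  rewrite -exprSr exprMn ler_wpM2l// exprS ler_piMr// exprn_ile1//.
have b3 : (c ^+ 2 * (p * q)) ^+ 2 <= c ^+ 3 * p.
  have -> : (c ^+ 2 * (p * q)) ^+ 2 = (c ^+ 3 * p) * (c * (p * q) * q) by ring.
  by rewrite ler_piMr ?mulr_ge0// mulr_ile1 ?mulr_ge0// mulr_ile1.
set A := heat m s (x + c * q) in H1 *; set B := heat m s (x - c * p) in H2 *.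
set D := heat m _ x in H3 *.
set h1 := heat_dx m s x in H1 H2; set h2 := heat_ds m s x in H1 H2 H3.
set h0 := heat m s x in H1 H2 H3.
have -> : p * A + q * B - D =
   p * (A - h0 - c * q * h1 - (c * q) ^+ 2 * h2)
   + q * (B - h0 - - (c * p) * h1 - (c * p) ^+ 2 * h2)
   - (D - h0 - c ^+ 2 * (p * q) * h2) by rewrite /q; ring.
apply: le_trans (ler_normB _ _) _.
apply: le_trans (lerD (ler_normD _ _) H3) _.
rewrite !normrM !(ger0_norm p0, ger0_norm q0).
have C1 : p * `|A - h0 - c * q * h1 - (c * q) ^+ 2 * h2| <= heat_const k * (c ^+ 3 * p).
  rewrite [leRHS]mulrA [leRHS]mulrC ler_wpM2l//.
  by apply: le_trans H1 _; rewrite ler_wpM2l.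
have C2 : q * `|B - h0 - - (c * p) * h1 - (c * p) ^+ 2 * h2| <= heat_const k * (c ^+ 3 * p).
  rewrite -[leRHS]mul1r ler_pM//.
  by apply: le_trans H2 _; rewrite ler_wpM2l.
have C3 : heat_const k * (c ^+ 2 * (p * q)) ^+ 2 <= heat_const k * (c ^+ 3 * p).
  by rewrite ler_wpM2l.
by lra.
Qed.

(** Conditioning on the first trial only shifts [x], so the induction hypothesis turns the other
    trials into the time increment c^2 V. The first trial is thus exchanged last, at the later time
    s + c^2 V, still at least [k], so the same constant serves. *)
Lemma poisson_binomial_heat ps (s x c : R) : k <= s -> 0 <= c <= 1 ->
  {in ps, forall p, 0 <= p <= 1} ->
  `|poisson_binomial ps (fun j => heat m s (x + c * (j%:R - \sum_(p <- ps) p))) -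
    heat m (s + c ^+ 2 * \sum_(p <- ps) (p * (1 - p))) x|
    <= 3 * heat_const k * (c ^+ 3 * \sum_(p <- ps) p).
Proof.
move=> ks c01; elim: ps x => [|p ps IH] x H.
  by rewrite /= !big_nil subrr !mulr0 !addr0 subrr normr0.
have p01 : 0 <= p <= 1 by apply: H; rewrite mem_head.
have Hps : {in ps, forall p, 0 <= p <= 1} by move=> r rp; apply: H; rewrite inE rp orbT.
rewrite /= !big_cons.
set S := \sum_(j <- ps) j; set V := \sum_(j <- ps) _.
pose F y := poisson_binomial ps (fun j => heat m s (y + c * (j%:R - S))).
rewrite (@eq_poisson_binomial ps _
  (fun j => heat m s ((x + c * (1 - p)) + c * (j%:R - S)))); last first.
  by move=> j; congr heat; rewrite -natr1; ring.
rewrite -/(F (x + c * (1 - p))).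
rewrite (@eq_poisson_binomial ps _
  (fun j => heat m s ((x - c * p) + c * (j%:R - S)))); last first.
  by move=> j; congr heat; ring.
rewrite -/(F (x - c * p)).
have V0 : 0 <= V.
  by rewrite /V big_seq sumr_ge0// => r /Hps /andP[r0 r1]; rewrite mulr_ge0// subr_ge0.
have := IH (x + c * (1 - p)) Hps; rewrite -/S -/V -/(F _) => I1.
have := IH (x - c * p) Hps; rewrite -/S -/V -/(F _) => I2.
have kt : k <= s + c ^+ 2 * V by rewrite (le_trans ks)// lerDl mulr_ge0// sqr_ge0.
have := bernoulli_step x kt c01 p01.
have -> : s + c ^+ 2 * (p * (1 - p) + V) = s + c ^+ 2 * V + c ^+ 2 * (p * (1 - p)) by ring.
set t := s + c ^+ 2 * V in I1 I2 *; set D := heat m (t + _) x.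
set A := heat m t _ in I1 *; set B := heat m t _ in I2 *.
move=> I3; move/andP: p01 => [p0 p1].
have q0 : 0 <= 1 - p by lra.
have -> : p * F (x + c * (1 - p)) + (1 - p) * F (x - c * p) - D =
  (p * (F (x + c * (1 - p)) - A) + (1 - p) * (F (x - c * p) - B)) +
  (p * A + (1 - p) * B - D) by ring.
apply: le_trans (ler_normD _ _) _.
apply: le_trans (lerD (ler_normD _ _) I3) _.
rewrite !normrM !(ger0_norm p0, ger0_norm q0).
have C1 := ler_wpM2l p0 I1.
have C2 := ler_wpM2l q0 I2.
apply: le_trans (lerD (lerD C1 C2) (lexx _)) _.
by rewrite le_eqVlt; apply/predU1P; left; ring.
Qed.

End poisson_binomial.

(** * Real-valued expectations *)

Section real_expectation.
Context d (T : measurableType d) (R : realType) (P : probability T R).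
Implicit Types f g h : T -> R.

Definition rintegrable f : Prop := P.-integrable setT (EFin \o f).

Lemma rintegrable_measurable f : rintegrable f -> measurable_fun setT f.
Proof. by case/integrableP => /measurable_EFinP. Qed.

Lemma bounded_rintegrable f M : measurable_fun setT f ->
  (forall x, `|f x| <= M) -> rintegrable f.
Proof.
move=> mf fM; apply: measurable_bounded_integrable => //.
  by rewrite fin_num_fun_lty// => A mA; rewrite fin_num_measure.
exists M; split; first exact: num_real.
by move=> r Mr x _; exact: le_trans (fM x) (ltW Mr).
Qed.

Lemma rintegrable_cst (c : R) : rintegrable (fun=> c).
Proof. by apply: (@bounded_rintegrable _ `|c|). Qed.

Lemma rintegrableD f g : rintegrable f -> rintegrable g ->
  rintegrable (fun x => f x + g x).
Proof.
move=> rf rg; have := integrableD measurableT rf rg.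
by apply: eq_integrable.
Qed.

Lemma rintegrableZ (c : R) f : rintegrable f -> rintegrable (fun x => c * f x).
Proof.
by move=> rf; have := integrableZl measurableT c rf; apply: eq_integrable.
Qed.

Lemma rintegrableB f g : rintegrable f -> rintegrable g ->
  rintegrable (fun x => f x - g x).
Proof.
move=> rf rg; have := integrableB measurableT rf rg.
by apply: eq_integrable.
Qed.

Lemma rintegrable_norm f : rintegrable f -> rintegrable (fun x => `|f x|).
Proof. exact: integrable_norm. Qed.

Lemma rintegrable_sum (I : Type) (s : seq I) (F : I -> T -> R) :
  (forall i, rintegrable (F i)) -> rintegrable (fun x => \sum_(i <- s) F i x).
Proof.
move=> rF; elim: s => [|i s IH].
  by under eq_fun do rewrite big_nil; exact: rintegrable_cst.
by under eq_fun do rewrite big_cons; exact: rintegrableD.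
Qed.

Lemma le_rintegrable f g : measurable_fun setT f ->
  (forall x, `|f x| <= g x) -> rintegrable g -> rintegrable f.
Proof.
move=> mf fg rg; apply: le_integrable rg => //; first exact/measurable_EFinP.
by move=> x _ /=; rewrite lee_fin (le_trans (fg x))// ler_norm.
Qed.

Lemma sqr_rintegrable f : measurable_fun setT f ->
  rintegrable (fun x => f x ^+ 2) -> rintegrable f.
Proof.
move=> mf rf2; apply: (@le_rintegrable _ (fun x => 1 + f x ^+ 2)) => //.
  by move=> x; rewrite -real_normK ?num_real//; have := normr_ge0 (f x); nra.
by apply: rintegrableD => //; exact: rintegrable_cst.
Qed.

Lemma rintegrable_bounded_mul h f M : measurable_fun setT h ->
  (forall x, `|h x| <= M) -> rintegrable f -> rintegrable (fun x => h x * f x).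
Proof.
move=> mh hM rf.
apply: (@le_rintegrable _ (fun x => M * `|f x|)).
- by apply: measurable_funM => //; exact: rintegrable_measurable.
- by move=> x; rewrite normrM ler_wpM2r.
- by apply: rintegrableZ; exact: rintegrable_norm.
Qed.

Lemma Rintegral_sum (I : Type) (s : seq I) (F : I -> T -> R) :
  (forall i, rintegrable (F i)) ->
  \int[P]_x (\sum_(i <- s) F i x) = \sum_(i <- s) \int[P]_x F i x.
Proof.
move=> rF; elim: s => [|i s IH].
  under eq_Rintegral do rewrite big_nil.
  by rewrite Rintegral_cst// mul0r big_nil.
under eq_Rintegral do rewrite big_cons.
by rewrite RintegralD ?IH ?big_cons//; [exact: rF|exact: rintegrable_sum].
Qed.

Lemma Rintegral_scale (c : R) f g : (forall x, g x = c * f x) -> rintegrable f ->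
  \int[P]_x g x = c * \int[P]_x f x.
Proof.
by move=> gE rf; rewrite -RintegralZl//; apply: eq_Rintegral => x _; rewrite gE.
Qed.

Lemma Rintegral_cstT (c : R) : \int[P]_x c = c.
Proof.
rewrite Rintegral_cst//.
by rewrite (_ : fine _ = 1) ?mulr1//; exact: (congr1 fine (probability_setT P)).
Qed.

(** Domination holds only almost everywhere because the edge estimates require all weights to be
    positive, an almost sure event. There [g] is nonnegative and may be replaced by its absolute
    value. *)
Lemma ae_le_Rintegral_norm f g : rintegrable f -> rintegrable g ->
  {ae P, forall x, `|f x| <= g x} -> `|\int[P]_x f x| <= \int[P]_x g x.
Proof.
move=> rf rg fg; apply: le_trans (le_normr_Rintegral _ _) _ => //.
have -> : \int[P]_x g x = \int[P]_x `|g x|.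
  rewrite /Rintegral; congr fine; apply: ae_eq_integral => //.
  - exact/measurable_EFinP/rintegrable_measurable.
  - by apply/measurable_EFinP/rintegrable_measurable; exact: rintegrable_norm.
  - apply: filterS fg => x H _; rewrite ger0_norm//.
    exact: le_trans (normr_ge0 _) H.
apply: fine_le; rewrite ?integrable_fin_num//; try exact: rintegrable_norm.
apply: ae_ge0_le_integral => //.
- by apply/measurable_EFinP/rintegrable_measurable; exact: rintegrable_norm.
- by apply/measurable_EFinP/rintegrable_measurable; exact: rintegrable_norm.
- apply: filterS fg => x /= H _; rewrite lee_fin (le_trans H)//.
  exact: ler_norm.
Qed.

Lemma ae_Rintegral_dist f g h : rintegrable f -> rintegrable g -> rintegrable h ->
  {ae P, forall x, `|f x - g x| <= h x} ->
  `|\int[P]_x f x - \int[P]_x g x| <= \int[P]_x h x.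
Proof.
move=> rf rg rh H; rewrite -RintegralB//.
by apply: ae_le_Rintegral_norm => //; exact: rintegrableB.
Qed.

Lemma Rintegral_dist f g h : rintegrable f -> rintegrable g -> rintegrable h ->
  (forall x, `|f x - g x| <= h x) ->
  `|\int[P]_x f x - \int[P]_x g x| <= \int[P]_x h x.
Proof.
by move=> rf rg rh H; apply: ae_Rintegral_dist => //; exact: aeW.
Qed.

Lemma Rintegral_indic_mul A f : measurable A ->
  \int[P]_x (\1_A x * f x) = \int[P]_(x in A) f x.
Proof.
move=> mA; rewrite [RHS]Rintegral_mkcond; apply: eq_Rintegral => x _.
by rewrite patchE indicE; case: ifP; rewrite ?mul1r ?mul0r.
Qed.

Lemma Rintegral_indic A : measurable A -> \int[P]_x (\1_A x : R) = fine (P A).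
Proof. by move=> mA; rewrite /Rintegral integral_indic// setIT. Qed.

Lemma Rintegral_dominated_cvg0 (f_ : nat -> T -> R) g :
    (forall n, measurable_fun setT (f_ n)) ->
    (forall x, f_ ^~ x @ \oo --> 0) ->
    (forall n x, `|f_ n x| <= g x) -> rintegrable g ->
  \int[P]_x f_ n x @[n --> \oo] --> 0.
Proof.
move=> mf f0 fg rg.
have [|||||_ _ H] := @dominated_convergence _ _ _ P setT measurableT
  (fun n x => (f_ n x)%:E) (cst 0%E) (EFin \o g).
- by move=> n; exact/measurable_EFinP.
- by [].
- by apply: aeW => x _; apply: cvg_EFin; [exact: nearW|exact: f0].
- exact: rg.
- by apply: aeW => x n _; rewrite lee_fin.
rewrite integral0 in H.
by have /fine_cvgP[_] := H.
Qed.

(** Serves to deduce [0 <= M] from a pointwise bound [|h x| <= M]. *)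
Lemma probability_inhabited : exists x : T, True.
Proof.
apply: contrapT => T0.
have /eqP : P setT = P set0.
  by congr (P _); apply/seteqP; split => // x _; case: T0; exists x.
by rewrite measure0 (_ : P _ = 1%E) ?onee_eq0//; exact: probability_setT.
Qed.

Section conditioning.
Variable G : set (set T).
Hypothesis Gm : G `<=` measurable.

Definition sub_measurable (h : T -> R) :=
  forall B : set R, measurable B -> G (h @^-1` B).

Lemma sub_measurableT h : sub_measurable h -> measurable_fun setT h.
Proof. by move=> Gh _ B mB; rewrite setTI; exact/Gm/Gh. Qed.

(* h is uniformly within 1 / (N + 1) of a linear combination of indicators of
   sets of G. *)
Let mul_unit_interval Z h : rintegrable Z -> sub_measurable h ->
  (forall x, 0 <= h x <= 1) ->
  (forall B, G B -> \int[P]_(x in B) Z x = 0) -> \int[P]_x (h x * Z x) = 0.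
Proof.
move=> rZ Gh h01 Z0.
have mh := sub_measurableT Gh.
have hb x : `|h x| <= 1 by have /andP[h0 h1] := h01 x; rewrite ger0_norm.
have key N : `|\int[P]_x (h x * Z x)| <= N.+1%:R^-1 * \int[P]_x `|Z x|.
  pose A (j : nat) := h @^-1` [set` `[j%:R / N.+1%:R, j.+1%:R / N.+1%:R[].
  have GA j : G (A j) by apply: Gh.
  have mA j : measurable (A j) by exact: Gm.
  have N0 : 0 < N.+1%:R :> R by rewrite ltr0n.
  (* The last index [N.+1] is that of the points where [h x = 1]. *)
  pose hN x : R := \sum_(j < N.+2) (j%:R / N.+1%:R) * \1_(A j) x.
  have hhN x : `|h x - hN x| <= N.+1%:R^-1.
    have /andP[h0 h1] := h01 x.
    have hN0 : 0 <= h x * N.+1%:R by rewrite mulr_ge0.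
    have /andP[j1 j2] := truncn_itv hN0.
    set j0 := Num.truncn _ in j1 j2.
    have AE (j : nat) : \1_(A j) x = (j == j0)%:R :> R.
      rewrite indicE; congr (_%:R); congr nat_of_bool; apply/idP/eqP.
        rewrite inE /A /= in_itv /= ler_pdivrMr// ltr_pdivlMr// => /andP[jh hj].
        have := le_lt_trans jh j2; have := le_lt_trans j1 hj.
        by rewrite !ltr_nat !ltnS => ? ?; apply/eqP; rewrite eqn_leq; apply/andP.
      by move=> ->; rewrite inE /A /= in_itv /= ler_pdivrMr// ltr_pdivlMr// j1.
    have j0N : (j0 < N.+2)%N.
      rewrite ltnS -(ler_nat R) (le_trans j1)//.
      by rewrite -[leRHS]mul1r ler_wpM2r// ltW.
    rewrite /hN (bigD1 (Ordinal j0N))//= big1 ?addr0; last first.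
      by move=> i ij; rewrite AE (_ : _ == _ = false) ?mulr0//; apply/negbTE.
    rewrite AE eqxx mulr1 ger0_norm; last by rewrite subr_ge0 ler_pdivrMr.
    by rewrite -(ler_pM2r N0) mulrBl mulVf ?gt_eqF// divfK ?gt_eqF//
      lerBlDl natr1 ltW.
  have rt (j : nat) : rintegrable (fun x => j%:R / N.+1%:R * \1_(A j) x * Z x).
    apply: (@rintegrable_bounded_mul
      (fun x => j%:R / N.+1%:R * \1_(A j) x) Z `|j%:R / N.+1%:R|) => //.
      by apply: measurable_funM => //; exact: measurable_indic.
    move=> x; rewrite normrM ler_piMr// indicE.
    by case: (_ \in _); rewrite ?normr1 ?normr0.
  have hNZ : \int[P]_x (hN x * Z x) = 0.
    under eq_Rintegral do rewrite mulr_suml.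
    rewrite Rintegral_sum; last by move=> j; exact: rt.
    rewrite big1// => j _.
    rewrite (@Rintegral_scale (j%:R / N.+1%:R) (fun x => \1_(A j) x * Z x)).
    - by rewrite Rintegral_indic_mul// Z0 ?mulr0.
    - by move=> x; rewrite mulrA.
    apply: (@rintegrable_bounded_mul \1_(A j) Z 1) => // x; rewrite indicE.
    by case: (_ \in _); rewrite ?normr1 ?normr0.
  rewrite -[X in `|X|]subr0 -hNZ -RintegralZl//; last exact: rintegrable_norm.
  apply: Rintegral_dist.
  - exact: rintegrable_bounded_mul rZ.
  - under eq_fun do rewrite mulr_suml; apply: rintegrable_sum => j; exact: rt.
  - by apply: rintegrableZ; exact: rintegrable_norm.
  - by move=> x; rewrite -mulrBl normrM ler_wpM2r.
apply/eqP; rewrite -normr_le0.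
set E := `|_| in key *; set F := \int[P]_x `|Z x| in key.
have F0 : 0 <= F by apply: Rintegral_ge0.
have [->//|FE] := eqVneq E 0.
have E0 : 0 < E by rewrite lt_def FE normr_ge0.
have := key (Num.truncn (F / E)).
have := truncnS_gt (F / E); set N := (Num.truncn _).+1 => H1 H2.
move: H2; rewrite -ler_pdivrMl ?invr_gt0 ?ltr0n// invrK.
by move: H1; rewrite ltr_pdivrMr// => /lt_le_trans /[apply]; rewrite ltxx.
Qed.

(** An affine change of [h] reduces to values in [0,1]. This does the work of conditional
    expectation: against a factor measurable for [G], one function may be replaced by another with
    the same integrals over [G]. *)
Lemma Rintegral_sub_measurable_mul X Y h M :
    rintegrable X -> rintegrable Y -> sub_measurable h ->
    (forall x, `|h x| <= M) ->
    (forall B, G B -> \int[P]_(x in B) X x = \int[P]_(x in B) Y x) ->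
  \int[P]_x (h x * X x) = \int[P]_x (h x * Y x).
Proof.
move=> rX rY Gh hM XY.
have mh := sub_measurableT Gh.
have rZ : rintegrable (fun x => X x - Y x) by exact: rintegrableB.
have Z0 B : G B -> \int[P]_(x in B) (X x - Y x) = 0.
  move=> GB; have mB := Gm GB.
  by rewrite RintegralB ?XY ?subrr//; apply: integrableS (measurableT) _ _ _.
have M0 : 0 <= M.
  by have [x _] := probability_inhabited; exact: le_trans (hM x).
(* The added 1 keeps the divisor positive when [M = 0]. *)
pose c := 2 * M + 1; have c0 : 0 < c by rewrite /c; lra.
pose g x := (h x + M) / c.
have g01 x : 0 <= g x <= 1.
  have := hM x; rewrite ler_norml => /andP[h1 h2].
  by rewrite /g divr_ge0 ?(ltW c0)//= ?ler_pdivrMr// /c; lra.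
have Gg : sub_measurable g.
  move=> B mB; rewrite (_ : g = (fun y => (y + M) / c) \o h)// comp_preimage.
  apply: Gh; rewrite -[X in measurable X]setTI.
  have : measurable_fun setT (fun y : R => (y + M) / c).
    by apply: measurable_funM => //; exact: measurable_funD.
  exact.
have gZ := mul_unit_interval rZ Gg g01 Z0.
have hE x : h x = c * g x - M by rewrite /g; field; rewrite gt_eqF.
apply/eqP; rewrite -subr_eq0 -RintegralB//; try exact: rintegrable_bounded_mul hM _.
rewrite (@eq_Rintegral _ _ _ P setT
  (fun x => c * (g x * (X x - Y x)) - M * (X x - Y x))); last first.
  by move=> x _; rewrite hE; ring.
have mg := sub_measurableT Gg.
have gb x : `|g x| <= 1 by have /andP[? ?] := g01 x; rewrite ger0_norm.
have rgZ := rintegrable_bounded_mul mg gb rZ.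
rewrite RintegralB//; try exact: rintegrableZ.
rewrite !RintegralZl// gZ Z0 ?mulr0 ?subrr//.
(* [G setT] comes from [h], as the preimage of the whole line. *)
by have := Gh setT measurableT; rewrite preimage_setT.
Qed.

End conditioning.
End real_expectation.

(** * Counting conditionally independent events *)

Section conditionally_independent_count.
Context d (T : measurableType d) (R : realType) (P : probability T R).
Variables (G : set (set T)) (K : finType) (A : K -> set T) (p : K -> T -> R).
Hypothesis GT : G setT.
Hypothesis mA : forall e, measurable (A e).
Hypothesis cond_p : forall e, is_cond_prob P G (A e) (p e).
Hypothesis indep : cond_independent P G A.

Let prod_indic (S : {set K}) (x : T) : R := \prod_(e in S) \1_(A e) x.

Let prod_p (S : {set K}) (x : T) : R := \prod_(e in S) p e x.

Let prod_indicE S : prod_indic S = \1_(\bigcap_(e in [set` S]) A e).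
Proof.
apply/funext => x; rewrite /prod_indic indicE.
have [xA|/negP xA] := boolP (x \in _).
  rewrite big1//= => e eS; rewrite indicE mem_set//.
  by move: xA; rewrite inE => /(_ e); apply.
have [e [eS xe]] : exists e, e \in S /\ ~ A e x.
  apply: contra_notP xA => H; rewrite inE => e /= eS.
  by apply: contrapT => xe; apply: H; exists e.
by rewrite (bigD1 e)//= indicE memNset// mul0r.
Qed.

Let mcap (S : {set K}) : measurable (\bigcap_(e in [set` S]) A e).
Proof. by apply: fin_bigcap_measurable => //; exact: finite_finset. Qed.

Let rintegrable_prod_indic S : rintegrable P (prod_indic S).
Proof.
rewrite prod_indicE; apply: (@bounded_rintegrable _ _ _ _ _ 1) => //.
by move=> x; rewrite indicE; case: (_ \in _); rewrite ?normr1 ?normr0.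
Qed.

(** The versions [p e] are not known to be bounded, so integrability of a product of them is taken
    from conditional independence, by which the product is itself a version of a conditional
    probability. *)
Let rintegrable_prod_p S : rintegrable P (prod_p S).
Proof. by have [] := @indep S p (fun e _ => cond_p e). Qed.

Let Rintegral_prod S : \int[P]_x prod_indic S x = \int[P]_x prod_p S x.
Proof.
have [_ _ /(_ setT GT)] := @indep S p (fun e _ => cond_p e).
by rewrite setIT prod_indicE Rintegral_indic// /Rintegral => ->.
Qed.

(* Since F (1_A + j) = 1_A F (j + 1) + F j - 1_A F j, both sides expand into
   the same combination of products over sets of indices, for which conditional
   independence gives the equality; the auxiliary set S collects the factors
   already extracted. *)
Lemma Rintegral_cond_independent_count (F : nat -> R) (M : R) :
  (forall j, `|F j| <= M) -> forall (es : seq K) (S : {set K}),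
  uniq es -> {in es, forall e, e \notin S} ->
  [/\ rintegrable P (fun x => prod_indic S x * F (\sum_(e <- es) (x \in A e))%N),
    rintegrable P (fun x => prod_p S x * poisson_binomial [seq p e x | e <- es] F) &
  \int[P]_x (prod_indic S x * F (\sum_(e <- es) (x \in A e))%N) =
  \int[P]_x (prod_p S x * poisson_binomial [seq p e x | e <- es] F)].
Proof.
move=> FM es; elim: es F FM => [|e es IH] F FM S /=.
  move=> _ _; split.
  - under eq_fun do rewrite big_nil mulrC; exact: rintegrableZ.
  - under eq_fun do rewrite mulrC; exact: rintegrableZ.
  transitivity (F 0%N * \int[P]_x prod_indic S x).
    by apply: Rintegral_scale => // x; rewrite big_nil mulrC.
  by rewrite Rintegral_prod; apply/esym/Rintegral_scale => // x; rewrite mulrC.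
move=> /andP[ees ues] eS.
have eS' : e \notin S by apply: eS; rewrite mem_head.
have H1 : {in es, forall f, f \notin e |: S}.
  move=> f fes; rewrite in_setU1 negb_or (eS f) ?inE ?fes ?orbT// andbT.
  by apply: contraNneq ees => <-.
have H2 : {in es, forall f, f \notin S} by move=> f fes; rewrite eS// inE fes orbT.
have [a1 a2 a3] := IH (fun j => F j.+1) (fun j => FM j.+1) (e |: S) ues H1.
have [b1 b2 b3] := IH F FM (e |: S) ues H1.
have [c1 c2 c3] := IH F FM S ues H2.
have eqI x : prod_indic S x * F (\sum_(f <- e :: es) (x \in A f))%N =
    prod_indic (e |: S) x * F (\sum_(f <- es) (x \in A f)).+1%N +
    prod_indic S x * F (\sum_(f <- es) (x \in A f))%N -
    prod_indic (e |: S) x * F (\sum_(f <- es) (x \in A f))%N.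
  rewrite big_cons /prod_indic big_setU1//= indicE.
  by case: (x \in A e); rewrite /= ?add1n ?add0n; ring.
have eqp x : prod_p S x * (p e x * poisson_binomial [seq p f x | f <- es] (fun j => F j.+1)
      + (1 - p e x) * poisson_binomial [seq p f x | f <- es] F) =
    prod_p (e |: S) x * poisson_binomial [seq p f x | f <- es] (fun j => F j.+1) +
    prod_p S x * poisson_binomial [seq p f x | f <- es] F -
    prod_p (e |: S) x * poisson_binomial [seq p f x | f <- es] F.
  by rewrite /prod_p big_setU1//=; ring.
split.
- by under eq_fun do rewrite eqI; apply: rintegrableB => //; exact: rintegrableD.
- by under eq_fun do rewrite eqp; apply: rintegrableB => //; exact: rintegrableD.
under eq_Rintegral do rewrite eqI.
under [RHS]eq_Rintegral do rewrite eqp.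
rewrite !RintegralB ?RintegralD ?a3 ?b3 ?c3//; exact: rintegrableD.
Qed.

End conditionally_independent_count.

(** * Independence *)

Section clip.
Context {R : realType}.
Implicit Types y : R.

(** Truncation to [-n, n]. Since [|y - clip n y| <= |y|], dominated convergence carries identities
    from bounded functions to integrable ones. *)
Definition clip (n : nat) y : R := Num.max (- n%:R) (Num.min n%:R y).

Lemma measurable_clip n : measurable_fun setT (clip n).
Proof. by apply: measurable_maxr => //; exact: measurable_minr. Qed.

Lemma clip_le n y : `|clip n y| <= n%:R.
Proof.
have n0 : 0 <= n%:R :> R by [].
by rewrite ler_norml /clip le_max lexx /= ge_max ge_min lexx andbT; lra.
Qed.

Lemma clip_id n y : `|y| <= n%:R -> clip n y = y.
Proof.
by rewrite ler_norml => /andP[f1 f2]; rewrite /clip min_r// max_r.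
Qed.

Lemma clip_dist n y : `|y - clip n y| <= `|y|.
Proof.
have n0 : 0 <= n%:R :> R by [].
have [/clip_id ->|] := leP `|y| n%:R; first by rewrite subrr normr0.
rewrite /clip ltr_normr => /orP[fn|fn].
  rewrite min_l ?(ltW fn)// max_r; last by lra.
  by rewrite !ger0_norm; lra.
rewrite min_r; last by lra.
rewrite max_l; last by lra.
by rewrite !ler0_norm; lra.
Qed.

Lemma clip_near y : \forall n \near \oo, clip n y = y.
Proof.
near=> n; apply: clip_id; near: n; exact: nbhs_infty_ger.
Unshelve. all: by end_near. Qed.

End clip.

Section independence_expectation.
Context d (T : measurableType d) (R : realType) (P : probability T R).
Variables (I : choiceType) (X : I -> {RV P >-> R}).
Hypothesis indep : mutually_independent X.
Variables (J : {fset I}) (j : I).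
Hypothesis jJ : j \notin J.

(** A family stable under intersection that generates the sigma-algebra of the [X i] with [i] in
    [J]; mutual independence speaks of exactly these events. *)
Definition rectangles : set (set T) :=
  [set A | exists2 B : I -> set R, (forall i, measurable (B i)) &
     A = \bigcap_(i in [set` J]) (X i @^-1` B i)].

Definition past : set (set T) := <<s rectangles >>.

Let rectangles_measurable : rectangles `<=` measurable.
Proof.
move=> _ [B mB ->]; apply: fin_bigcap_measurable; first exact: finite_fset.
by move=> i _; exact: measurable_funPTI.
Qed.

Let rectanglesI : setI_closed rectangles.
Proof.
move=> _ _ [B mB ->] [C mC ->]; exists (fun i => B i `&` C i).
  by move=> i; exact: measurableI.
by rewrite -bigcapI; apply: eq_bigcapr => i _; rewrite preimage_setI.
Qed.

Lemma past_measurable : past `<=` measurable.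
Proof. by apply: smallest_sub => //; exact: sigma_algebra_measurable. Qed.

Let rectanglesT : rectangles setT.
Proof.
exists (fun=> setT) => //.
by rewrite bigcapT.
Qed.

Let rectangle_indep A C : rectangles A -> measurable C ->
  P (A `&` X j @^-1` C) = (P A * P (X j @^-1` C))%E.
Proof.
move=> [B mB ->] mC.
pose B' i := if i == j then C else B i.
have mB' i : measurable (B' i) by rewrite /B'; case: ifP.
have BJ i : i \in J -> B' i = B i.
  by move=> iJ; rewrite /B'; case: eqP => // ij; move: jJ; rewrite -ij iJ.
have := @indep (j |` J)%fset B' (fun i _ => mB' i).
rewrite big_fsetU1//= {2}/B' eqxx.
have -> : (\prod_(i <- J) P (X i @^-1` B' i) = P (\bigcap_(i in [set` J]) (X i @^-1` B i)))%E.
  rewrite indep//; rewrite big_seq [RHS]big_seq; apply: eq_bigr => i iJ.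
  by rewrite BJ.
rewrite muleC => <-; congr (P _).
apply/seteqP; split => x.
  move=> [H1 H2] i /=; rewrite in_fset1U => /orP[/eqP->|iJ]; first by rewrite /B' eqxx.
  by rewrite BJ//; exact: H1.
move=> H; split; last first.
  by have := H j; rewrite /= fset1U1 /B' eqxx; apply.
by move=> i iJ /=; rewrite -BJ//; apply: H; rewrite /= in_fset1U iJ orbT.
Qed.

(** With D the event that [X j] lies in C, the finite measures A -> P(A and D) and A -> P(A) P(D)
    agree on rectangles, hence on the sigma-algebra they generate. *)
Lemma past_indep A C : past A -> measurable C ->
  P (A `&` X j @^-1` C) = (P A * P (X j @^-1` C))%E.
Proof.
move=> pA mC.
have mD : measurable (X j @^-1` C) by exact: measurable_funPTI.
have PD0 : 0 <= fine (P (X j @^-1` C)) by exact: fine_ge0.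
pose m1 := mrestr P mD.
pose m2 := mscale (NngNum PD0) P.
have m2E B : m2 B = (P B * P (X j @^-1` C))%E.
  by rewrite /m2 /mscale /= fineK ?fin_num_measure// muleC.
transitivity (m2 A); last exact: m2E.
rewrite -[LHS]/(m1 A).
apply: (@g_sigma_algebra_measure_unique _ _ _ rectangles rectangles_measurable
  (fun=> setT) _ _ m1 m2) => //.
- by rewrite bigcup_const.
- by move=> B rB; transitivity (P B * P (X j @^-1` C))%E;
    [exact: rectangle_indep|exact/esym/m2E].
- move=> _; rewrite /m1 /= /mrestr /= setTI.
  by apply: (le_lt_trans (probability_le1 _ mD)); rewrite ltry.
Qed.

Lemma past_sub_measurable (i : I) : i \in J -> sub_measurable past (X i).
Proof.
move=> iJ B mB; apply: sub_sigma_algebra.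
exists (fun k => if k == i then B else setT); first by move=> k; case: ifP.
apply/seteqP; split => x /=.
  by move=> Bx k _ /=; case: eqP => // ->.
by move=> /(_ i iJ) /=; rewrite eqxx.
Qed.

(** Makes the closure properties of measurable functions, such as sums and compositions, available
    for [past]. *)
Lemma past_sub_measurableE (h : T -> R) : sub_measurable past h <->
  measurable_fun setT (h : g_sigma_algebraType rectangles -> R).
Proof.
split=> [sh _ B mB|mh B mB].
  by rewrite setTI; exact: sh.
by rewrite -[_ @^-1` _]setTI; exact: mh.
Qed.

(** Two replacements. Over events of the past, the indicator of an event D of [X j] has the same
    integral as the constant P(D); since [h] is measurable for the past, [h] and its mean have the
    same integral over D. As f(X j) is measurable for the sigma-algebra of these D, [h] may then be
    replaced by its mean in front of f(X j). *)
Let Rintegral_indep_bounded (h : T -> R) (f : R -> R) (M N : R) :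
    sub_measurable past h -> (forall x, `|h x| <= M) ->
    measurable_fun setT f -> (forall y, `|f y| <= N) ->
  \int[P]_x (h x * f (X j x)) = \int[P]_x h x * \int[P]_x f (X j x).
Proof.
move=> ph hM mf fN.
have mh := sub_measurableT past_measurable ph.
have rh : rintegrable P h by exact: bounded_rintegrable hM.
have mfX : measurable_fun setT (f \o X j) by exact: measurableT_comp.
have rf : rintegrable P (fun x => f (X j x)).
  by apply: (@bounded_rintegrable _ _ _ _ _ N).
pose G := [set X j @^-1` C | C in measurable].
have Gm : G `<=` measurable by move=> _ [C mC <-]; exact: measurable_funPTI.
have H1 B : G B -> \int[P]_(x in B) h x = \int[P]_(x in B) (\int[P]_x h x).
  move=> [C mC <-]; set D := _ @^-1` _.
  have mD : measurable D by exact: measurable_funPTI.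
  rewrite Rintegral_cst// -Rintegral_indic_mul//.
  under eq_Rintegral do rewrite mulrC.
  rewrite (@Rintegral_sub_measurable_mul _ _ _ _ past past_measurable _
    (fun=> fine (P D)) h M)//.
  - by rewrite RintegralZr.
  - apply: (@bounded_rintegrable _ _ _ _ _ 1) => // x.
    by rewrite indicE; case: (_ \in _); rewrite ?normr1 ?normr0.
  - exact: rintegrable_cst.
  move=> E pE; have mE := past_measurable pE.
  have PED : P (E `&` D) = (P E * P D)%E by exact: past_indep.
  transitivity (fine (P (E `&` D))); first by rewrite /Rintegral integral_indic// setIC.
  rewrite PED Rintegral_cst//.
  by rewrite fineM ?fin_num_measure// mulrC.
under eq_Rintegral do rewrite mulrC.
rewrite (@Rintegral_sub_measurable_mul _ _ _ _ G Gm h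
  (fun=> \int[P]_x h x) (fun x => f (X j x)) N)//.
- by rewrite RintegralZr// mulrC.
- exact: rintegrable_cst.
move=> B mB; exists (f @^-1` B) => //.
by rewrite -[_ @^-1` _]setTI; exact: mf.
Qed.

(** Truncating [f] at level n changes each side by at most M times the mean of |f - clip n f|, which
    tends to 0; the two sides do not depend on n. *)
Lemma Rintegral_indep (h : T -> R) (f : R -> R) (M : R) :
    sub_measurable past h -> (forall x, `|h x| <= M) ->
    measurable_fun setT f -> rintegrable P (fun x => f (X j x)) ->
  \int[P]_x (h x * f (X j x)) = \int[P]_x h x * \int[P]_x f (X j x).
Proof.
move=> ph hM mf rf.
have mh := sub_measurableT past_measurable ph.
have rclip n : rintegrable P (fun x => clip n (f (X j x))).
  apply: (@bounded_rintegrable _ _ _ _ _ n%:R); last by move=> x; exact: clip_le.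
  by apply: measurableT_comp (measurable_clip n) _; exact: measurableT_comp.
have rdist n : rintegrable P (fun x => `|f (X j x) - clip n (f (X j x))|).
  by apply: rintegrable_norm; exact: rintegrableB.
have err0 : \int[P]_x `|f (X j x) - clip n (f (X j x))| @[n --> \oo] --> 0.
  apply: (@Rintegral_dominated_cvg0 _ _ _ _ _ (fun x => `|f (X j x)|)).
  - by move=> n; exact: rintegrable_measurable (rdist n).
  - move=> x; apply/cvgrPdist_le => e e0; near=> n.
    have -> : clip n (f (X j x)) = f (X j x) by near: n; exact: clip_near.
    by rewrite subrr normr0 subr0 normr0 ltW.
  - by move=> n x; rewrite normr_id; exact: clip_dist.
  - exact: rintegrable_norm.
have M0 : 0 <= M by have [x _] := probability_inhabited P; exact: le_trans (hM x).
set L := LHS; set Q := RHS.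
have key n : `|L - Q| <= 2 * M * \int[P]_x `|f (X j x) - clip n (f (X j x))|.
  have e1 : `|L - \int[P]_x (h x * clip n (f (X j x)))| <=
      M * \int[P]_x `|f (X j x) - clip n (f (X j x))|.
    rewrite -RintegralZl//; last exact: rdist.
    apply: Rintegral_dist; try exact: rintegrable_bounded_mul hM _.
      exact: rintegrableZ.
    by move=> x; rewrite -mulrBr normrM ler_wpM2r.
  rewrite (Rintegral_indep_bounded ph hM
    (measurableT_comp (measurable_clip n) mf) (fun y => clip_le n (f y))) in e1.
  have e2 : `|\int[P]_x f (X j x) - \int[P]_x clip n (f (X j x))| <=
      \int[P]_x `|f (X j x) - clip n (f (X j x))|.
    exact: Rintegral_dist.
  have e3 : `|\int[P]_x h x| <= M.
    rewrite -[leRHS](Rintegral_cstT P); apply: ae_le_Rintegral_norm => //.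
    - exact: bounded_rintegrable hM.
    - exact: rintegrable_cst.
    - exact: aeW.
  have -> : L - Q = (L - \int[P]_x h x * \int[P]_x clip n (f (X j x))) -
      \int[P]_x h x * (\int[P]_x f (X j x) - \int[P]_x clip n (f (X j x))).
    by rewrite /Q; ring.
  apply: le_trans (ler_normB _ _) _; rewrite normrM.
  have e4 := ler_pM (normr_ge0 _) (normr_ge0 _) e3 e2.
  by lra.
apply/eqP; rewrite -subr_eq0 -normr_le0.
have lim0 : 2 * M * \int[P]_x `|f (X j x) - clip n (f (X j x))| @[n --> \oo] --> 2 * M * 0.
  by apply: cvgM => //; exact: cvg_cst.
rewrite mulr0 in lim0.
rewrite -(cvg_lim (@Rhausdorff R) lim0); apply: limr_ge; first exact: (cvgP _ lim0).
exact: nearW.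
Unshelve. all: by end_near.
Qed.

(** This removes the cross terms in the variance of a sum, where [h] is an unbounded partial sum.
    Here [h] is truncated rather than [f], which keeps the mean of [f] equal to 0, so every
    truncated product has integral 0. Domination is by |h f| <= h^2 + f^2. *)
Lemma Rintegral_indep_centered (h : T -> R) (f : R -> R) :
    sub_measurable past h -> measurable_fun setT f ->
    rintegrable P (fun x => h x ^+ 2) -> rintegrable P (fun x => f (X j x) ^+ 2) ->
    rintegrable P (fun x => f (X j x)) -> \int[P]_x f (X j x) = 0 ->
  rintegrable P (fun x => h x * f (X j x)) /\ \int[P]_x (h x * f (X j x)) = 0.
Proof.
move=> ph mf rh2 rf2 rf f0.
have mh := sub_measurableT past_measurable ph.
have rg : rintegrable P (fun x => h x ^+ 2 + f (X j x) ^+ 2) by exact: rintegrableD.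
have hf x : `|h x| * `|f (X j x)| <= h x ^+ 2 + f (X j x) ^+ 2.
  rewrite -[h x ^+ 2]real_normK ?num_real// -[f _ ^+ 2]real_normK ?num_real//.
  by have := sqr_ge0 (`|h x| - `|f (X j x)|); have := sqr_ge0 `|h x|;
    have := sqr_ge0 `|f (X j x)|; nra.
have mfX : measurable_fun setT (fun x => f (X j x)) by exact: measurableT_comp.
have rhf : rintegrable P (fun x => h x * f (X j x)).
  apply: le_rintegrable rg; first exact: measurable_funM.
  by move=> x; rewrite normrM.
split=> //.
have pclip n : sub_measurable past (fun x => clip n (h x)).
  by apply/past_sub_measurableE; apply: measurableT_comp (measurable_clip n) _;
    exact/past_sub_measurableE.
have rclip n : rintegrable P (fun x => clip n (h x) * f (X j x)).
  apply: rintegrable_bounded_mul rf; last by move=> x; exact: clip_le.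
  exact: measurableT_comp (measurable_clip n) _.
have rdist n : rintegrable P (fun x => `|h x * f (X j x) - clip n (h x) * f (X j x)|).
  by apply: rintegrable_norm; exact: rintegrableB.
have err0 : \int[P]_x `|h x * f (X j x) - clip n (h x) * f (X j x)| @[n --> \oo] --> 0.
  apply: Rintegral_dominated_cvg0 rg.
  - by move=> n; exact: rintegrable_measurable (rdist n).
  - move=> x; apply/cvgrPdist_le => e e0; near=> n.
    have -> : clip n (h x) = h x by near: n; exact: clip_near.
    by rewrite subrr normr0 subr0 normr0 ltW.
  - move=> n x; rewrite normr_id -mulrBl normrM; apply: le_trans (hf x).
    by rewrite ler_wpM2r// clip_dist.
apply/eqP; rewrite -normr_le0.
rewrite -(cvg_lim (@Rhausdorff R) err0); apply: limr_ge; first exact: (cvgP _ err0).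
apply: nearW => n.
have e0 : \int[P]_x (clip n (h x) * f (X j x)) = 0.
  by rewrite (Rintegral_indep (pclip n) (fun x => clip_le n (h x)) mf rf) f0 mulr0.
rewrite -[X in `|X| <= _]subr0 -e0; apply: Rintegral_dist => //.
Unshelve. all: by end_near.
Qed.

End independence_expectation.

(** * Lindeberg's theorem for the weights *)

Section identically_distributed.
Context d (T : measurableType d) (R : realType) (P : probability T R).

Lemma identically_distributed_rintegrable (X Y : {RV P >-> R}) (f : R -> R) :
    identically_distributed X Y -> measurable_fun setT f ->
    rintegrable P (fun x => f (X x)) ->
  rintegrable P (fun x => f (Y x)) /\
  \int[P]_x f (Y x) = \int[P]_x f (X x).
Proof.
move=> XY mf rX.
have mEf : measurable_fun setT (EFin \o f) by exact/measurable_EFinP.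
have rY : rintegrable P (fun x => f (Y x)).
  apply/integrableP; split.
    by apply/measurable_EFinP; exact: measurableT_comp.
  have /integrableP[_] := rX; apply: le_lt_trans.
  rewrite -(@ge0_integral_distribution _ _ _ _ _ _ Y (fun y => `|(f y)%:E|%E))//; last first.
    exact: measurableT_comp.
  rewrite -(@ge0_integral_distribution _ _ _ _ _ _ X (fun y => `|(f y)%:E|%E))//; last first.
    exact: measurableT_comp.
  rewrite le_eqVlt; apply/predU1P; left.
  by apply: eq_measure_integral => A mA _; apply/esym/XY.
split => //; rewrite /Rintegral; congr fine.
rewrite -(@integral_distribution _ _ _ _ _ _ Y (EFin \o f))//.
rewrite -(@integral_distribution _ _ _ _ _ _ X (EFin \o f))//.
by apply: eq_measure_integral => A mA _; apply/esym/XY.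
Qed.

End identically_distributed.

Section lindeberg.
Context d (T : measurableType d) (R : realType) (P : probability T R).
Variable W : nat -> {RV P >-> R}.
Hypothesis W_iid : iid W.
Hypothesis rW2 : rintegrable P (fun x => W 0%N x ^+ 2).

Let mu : R := \int[P]_x W 0%N x.

Let var : R := \int[P]_x (W 0%N x - mu) ^+ 2.

Let rW : rintegrable P (W 0%N).
Proof. exact: sqr_rintegrable rW2. Qed.

Lemma iid_rintegrable (f : R -> R) i : measurable_fun setT f ->
  rintegrable P (fun x => f (W 0%N x)) ->
  rintegrable P (fun x => f (W i x)) /\ \int[P]_x f (W i x) = \int[P]_x f (W 0%N x).
Proof.
by move=> mf rf; apply: identically_distributed_rintegrable => //; exact: W_iid.2.
Qed.

Let centered2 : rintegrable P (fun x => (W 0%N x - mu) ^+ 2).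
Proof.
have -> : (fun x => (W 0%N x - mu) ^+ 2) =
    fun x => W 0%N x ^+ 2 + ((- 2 * mu) * W 0%N x + mu ^+ 2).
  by apply/funext => x; ring.
apply: rintegrableD => //; apply: rintegrableD; last exact: rintegrable_cst.
exact: rintegrableZ.
Qed.

Lemma iid_centered i : rintegrable P (fun x => W i x - mu) /\
  \int[P]_x (W i x - mu) = 0.
Proof.
have [] := @iid_rintegrable (fun y => y - mu) i.
- exact: measurable_funD.
- by apply: rintegrableB => //; exact: rintegrable_cst.
move=> r ->; split; first exact: r.
have rc := rintegrable_cst P mu.
by rewrite RintegralB// Rintegral_cstT subrr.
Qed.

Lemma iid_centered2 i : rintegrable P (fun x => (W i x - mu) ^+ 2) /\
  \int[P]_x (W i x - mu) ^+ 2 = var.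
Proof.
have [] // := @iid_rintegrable (fun y => (y - mu) ^+ 2) i.
by apply: measurable_funX; exact: measurable_funD.
Qed.

(** The mean, up to the constant, of the space remainder for one rescaled centered weight. The
    cutoff by 1 makes it finite under a second moment alone. *)
Definition lindeberg_error (a : R) : R :=
  \int[P]_x ((a * (W 0%N x - mu)) ^+ 2 * Num.min 1 `|a * (W 0%N x - mu)|).

Lemma iid_lindeberg_error (a : R) i :
  let f y := (a * (y - mu)) ^+ 2 * Num.min 1 `|a * (y - mu)| in
  rintegrable P (fun x => f (W i x)) /\
  \int[P]_x f (W i x) = lindeberg_error a.
Proof.
move=> f.
have mf : measurable_fun setT f.
  have ma : measurable_fun setT (fun y : R => a * (y - mu)).
    by apply: measurable_funM => //; exact: measurable_funD.
  apply: measurable_funM; first exact: measurable_funX.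
  by apply: measurable_minr => //; exact: measurableT_comp.
apply: iid_rintegrable => //.
apply: (@le_rintegrable _ _ _ _ _ (fun x => a ^+ 2 * (W 0%N x - mu) ^+ 2)).
- exact: measurableT_comp.
- move=> x; rewrite /f exprMn normrM.
  have y0 : 0 <= Num.min 1 `|a * (W 0%N x - mu)| by rewrite le_min ler01 normr_ge0.
  have z0 : 0 <= a ^+ 2 * (W 0%N x - mu) ^+ 2 by rewrite mulr_ge0 ?sqr_ge0.
  by rewrite (ger0_norm y0) (ger0_norm z0) ler_piMr// ge_min lexx.
- exact: rintegrableZ.
Qed.

Let partial_sum n x : R := \sum_(i < n) (W i.+1 x - mu).

Let vertices n : {fset nat} := [fset i in iota 1 n]%fset.

Let partial_sum_past n (h : R -> R) (a : R) : measurable_fun setT h ->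
  sub_measurable (past W (vertices n)) (fun x => h (a * partial_sum n x)).
Proof.
move=> mh; apply/past_sub_measurableE.
apply: (measurableT_comp mh); apply: measurable_funM => //.
apply: measurable_sum => i; apply: measurable_funB => //.
apply/past_sub_measurableE; apply: past_sub_measurable.
by rewrite !inE mem_iota /= add1n ltnS.
Qed.

Let fresh n : n.+1 \notin vertices n.
Proof. by rewrite !inE mem_iota /= add1n ltnn. Qed.

Lemma variance_sum n :
  rintegrable P (fun x => (\sum_(i < n) (W i.+1 x - mu)) ^+ 2) /\
  \int[P]_x (\sum_(i < n) (W i.+1 x - mu)) ^+ 2 = n%:R * var.
Proof.
elim: n => [|n [rn En]].
  have -> : (fun x => (\sum_(i < 0) (W i.+1 x - mu)) ^+ 2) = (fun=> 0).
    by apply/funext => x; rewrite big_ord0 expr0n.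
  by split; [exact: rintegrable_cst|rewrite Rintegral_cstT mul0r].
have [r1 E1] := iid_centered n.+1; have [r2 E2] := iid_centered2 n.+1.
have past_sum : sub_measurable (past W (vertices n)) (fun x => \sum_(i < n) (W i.+1 x - mu)).
  have := @partial_sum_past n id 1 (@measurable_id _ _ _).
  by under eq_fun do rewrite /= mul1r.
have [r3 E3] := Rintegral_indep_centered W_iid.1 (fresh n) past_sum
  (measurable_funB (@measurable_id _ _ _) (measurable_cst mu)) rn r2 r1 E1.
have sqE x : (\sum_(i < n.+1) (W i.+1 x - mu)) ^+ 2 =
    (\sum_(i < n) (W i.+1 x - mu)) ^+ 2 +
    (2 * ((\sum_(i < n) (W i.+1 x - mu)) * (W n.+1 x - mu)) + (W n.+1 x - mu) ^+ 2).
  by rewrite big_ord_recr /=; ring.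
have r4 := rintegrableZ 2 r3.
split.
  by under eq_fun do rewrite sqE; apply: rintegrableD => //; exact: rintegrableD.
under eq_Rintegral do rewrite sqE.
rewrite RintegralD//; last exact: rintegrableD.
rewrite RintegralD// RintegralZl// En E2 E3 mulr0 add0r -natr1.
by ring.
Qed.

Variables (m k : R).
Hypothesis k0 : 0 < k.

Lemma lindeberg_step n (s a : R) : k <= s ->
  `|\int[P]_x heat m s (a * partial_sum n.+1 x) -
    \int[P]_x heat m (s + a ^+ 2 * var) (a * partial_sum n x)| <=
  heat_const k * (lindeberg_error a + (a ^+ 2 * var) ^+ 2).
Proof.
move=> ks.
pose S x := a * partial_sum n x; pose eta x := W n.+1 x - mu.
have var0 : 0 <= var by apply: Rintegral_ge0 => x _; exact: sqr_ge0.
have t0 : 0 <= a ^+ 2 * var by rewrite mulr_ge0 ?sqr_ge0.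
have past_h (h : R -> R) := @partial_sum_past n h a.
have sT (h : R -> R) : measurable_fun setT h -> measurable_fun setT (fun x => h (S x)).
  by move=> mh; apply: sub_measurableT (past_h _ mh); exact: past_measurable.
have mh u := measurable_heat m u.
have rheat u (Z : T -> R) : measurable_fun setT Z -> rintegrable P (fun x => heat m u (Z x)).
  move=> mZ; apply: (@bounded_rintegrable _ _ _ _ _ 1).
    exact: measurableT_comp (mh u) mZ.
  by move=> x; rewrite ger0_norm ?heat_ge0 ?heat_le1.
have mS : measurable_fun setT S by exact: (sT id).
have [r1 E1] := iid_centered n.+1; have [r2 E2] := iid_centered2 n.+1.
have [rL EL] := iid_lindeberg_error a n.+1.
have rdx : rintegrable P (fun x => heat_dx m s (S x) * (W n.+1 x - mu)).
  apply: (@rintegrable_bounded_mul _ _ _ _ _ _ (heat_const k) _ _ r1).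
    exact: sT _ (measurable_heat_dx m s).
  by move=> x; exact: heat_dx_le.
have rds : rintegrable P (fun x => heat_ds m s (S x) * (W n.+1 x - mu) ^+ 2).
  apply: (@rintegrable_bounded_mul _ _ _ _ _ _ (heat_const k) _ _ r2).
    exact: sT _ (measurable_heat_ds m s).
  by move=> x; exact: heat_ds_le.
have rds1 : rintegrable P (fun x => heat_ds m s (S x)).
  apply: (@bounded_rintegrable _ _ _ _ _ (heat_const k)).
    exact: sT _ (measurable_heat_ds m s).
  by move=> x; exact: heat_ds_le.
have I1 : \int[P]_x (heat_dx m s (S x) * (W n.+1 x - mu)) = 0.
  rewrite (@Rintegral_indep _ _ _ _ _ _ W_iid.1 _ _ (fresh n) _
    (fun y => y - mu) (heat_const k)).
  - by rewrite E1 mulr0.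
  - exact: past_h _ (measurable_heat_dx m s).
  - by move=> x; exact: heat_dx_le.
  - exact: measurable_funB.
  - exact: r1.
have I2 : \int[P]_x (heat_ds m s (S x) * (W n.+1 x - mu) ^+ 2) =
    var * \int[P]_x heat_ds m s (S x).
  rewrite (@Rintegral_indep _ _ _ _ _ _ W_iid.1 _ _ (fresh n) _
    (fun y => (y - mu) ^+ 2) (heat_const k)).
  - by rewrite E2 mulrC.
  - exact: past_h _ (measurable_heat_ds m s).
  - by move=> x; exact: heat_ds_le.
  - by apply: measurable_funX; exact: measurable_funB.
  - exact: r2.
(* [Q] is the space expansion of [heat] around [S x] and [Q'] its time expansion. Independence of
   the new weight from [S] gives them the same mean. *)
pose Q x := heat m s (S x) + (a * (heat_dx m s (S x) * (W n.+1 x - mu)) +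
   a ^+ 2 * (heat_ds m s (S x) * (W n.+1 x - mu) ^+ 2)).
pose Q' x := heat m s (S x) + (a ^+ 2 * var) * heat_ds m s (S x).
have rQ : rintegrable P Q.
  by apply: rintegrableD; [exact: rheat|apply: rintegrableD; exact: rintegrableZ].
have rQ' : rintegrable P Q'.
  by apply: rintegrableD; [exact: rheat|exact: rintegrableZ].
have QQ' : \int[P]_x Q x = \int[P]_x Q' x.
  rewrite RintegralD//; last 2 first.
  - exact: rheat.
  - by apply: rintegrableD; exact: rintegrableZ.
  rewrite RintegralD//; last 2 first.
  - exact: rintegrableZ.
  - exact: rintegrableZ.
  rewrite RintegralD//; last 2 first.
  - exact: rheat.
  - exact: rintegrableZ.
  by rewrite !RintegralZl// I1 I2 mulr0 add0r mulrA.
have SE x : a * partial_sum n.+1 x = S x + a * (W n.+1 x - mu).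
  by rewrite /partial_sum big_ord_recr /= mulrDr.
have D1 : `|\int[P]_x heat m s (a * partial_sum n.+1 x) - \int[P]_x Q x|
    <= heat_const k * lindeberg_error a.
  rewrite -EL -RintegralZl//; apply: Rintegral_dist => //.
  - under eq_fun do rewrite SE; apply: rheat; apply: measurable_funD => //.
    by apply: measurable_funM => //; exact: measurable_funB.
  - exact: rintegrableZ.
  - move=> x; rewrite SE.
    have := heat_taylor_space m k0 (S x) (a * (W n.+1 x - mu)) ks.
    by congr (_ <= _); congr `|_|; rewrite /Q; ring.
have D2 : `|\int[P]_x heat m (s + a ^+ 2 * var) (S x) - \int[P]_x Q' x|
    <= heat_const k * (a ^+ 2 * var) ^+ 2.
  rewrite -[leRHS](Rintegral_cstT P); apply: Rintegral_dist => //.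
  - exact: rheat.
  - exact: rintegrable_cst.
  - move=> x; have := heat_taylor_time m k0 (S x) ks t0.
    by congr (_ <= _); congr `|_|; rewrite /Q'; ring.
rewrite mulrDr; apply: le_trans (lerD D1 D2).
rewrite QQ'; apply: le_trans (ler_distD (\int[P]_x Q' x) _ _) _.
by rewrite lerD2l distrC.
Qed.

Lemma lindeberg_sum n (s a : R) : k <= s ->
  `|\int[P]_x heat m s (a * partial_sum n x) - heat m (s + n%:R * (a ^+ 2 * var)) 0| <=
  n%:R * (heat_const k * (lindeberg_error a + (a ^+ 2 * var) ^+ 2)).
Proof.
have var0 : 0 <= var by apply: Rintegral_ge0 => x _; exact: sqr_ge0.
have t0 : 0 <= a ^+ 2 * var by rewrite mulr_ge0 ?sqr_ge0.
elim: n s => [|n IH] s ks.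
  under eq_Rintegral do rewrite /partial_sum big_ord0 mulr0.
  by rewrite Rintegral_cstT !mul0r addr0 subrr normr0.
have ks' : k <= s + a ^+ 2 * var by rewrite (le_trans ks)// lerDl.
have I1 := IH _ ks'; have I2 := lindeberg_step n a ks.
have -> : s + n.+1%:R * (a ^+ 2 * var) = s + a ^+ 2 * var + n%:R * (a ^+ 2 * var).
  by rewrite -natr1; ring.
rewrite -natr1 [leRHS]mulrDl mul1r [leRHS]addrC.
apply: le_trans (lerD I2 I1).
by apply: le_trans (ler_distD _ _ _) _.
Qed.

End lindeberg.

(** * Deterministic estimates on the edge probabilities *)

Section real_inequalities.
Context {R : realType}.

Lemma dist_unit_interval (x y : R) :
  0 <= x <= 1 -> 0 <= y <= 1 -> `|x - y| <= 1.
Proof. by move=> /andP[? ?] /andP[? ?]; rewrite ler_norml; lra. Qed.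

(** The displacements in time and in position that remain after the edge exchange, where N is the
    number of vertices, S and S2 are the sums of p_ij and p_ij^2, and q = Q / L. Since 2 mu / v = 2
    mu a^2 N, writing 2 S = L - (L - 2 S) turns the time displacement into 2 a^2 (L - N mu) minus a
    nonnegative term at most 4 a^2 (q + q^2). *)
Lemma edge_error_le (a N mu v L S S2 q : R) :
    0 < a <= 1 -> 0 < v -> N * a ^+ 2 * v = 1 -> 0 <= q ->
    0 <= L - 2 * S <= q + q ^+ 2 -> 0 <= S2 -> 2 * S2 <= q ^+ 2 ->
  `|(2 * a) ^+ 2 * (S - S2) - 2 * mu / v| +
    `|a * (2 * S - N * mu) - a * (L - N * mu)| <=
  2 * a ^+ 2 * `|L - N * mu| + 7 * a * (q + q ^+ 2).
Proof.
move=> /andP[a0 a1] v0 nav q0 /andP[S0 S1] S20 S2q.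
have a20 : 0 <= a ^+ 2 by exact: sqr_ge0.
have a220 : 0 <= 2 * a ^+ 2 by rewrite mulr_ge0.
have e1 : `|a * (2 * S - N * mu) - a * (L - N * mu)| = a * (L - 2 * S).
  have -> : a * (2 * S - N * mu) - a * (L - N * mu) = - (a * (L - 2 * S)) by ring.
  by rewrite normrN ger0_norm// mulr_ge0// ltW.
have -> : 2 * mu / v = 2 * mu * a ^+ 2 * N.
  have -> : 2 * mu / v = 2 * mu / v * (N * a ^+ 2 * v) by rewrite nav mulr1.
  by field; rewrite gt_eqF.
have -> : (2 * a) ^+ 2 * (S - S2) - 2 * mu * a ^+ 2 * N =
    2 * a ^+ 2 * (L - N * mu) - (2 * a ^+ 2 * (L - 2 * S) + 4 * a ^+ 2 * S2) by ring.
rewrite e1.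
set f := 2 * a ^+ 2 * (L - 2 * S) + 4 * a ^+ 2 * S2.
have f0 : 0 <= f by rewrite addr_ge0// mulr_ge0// mulr_ge0.
have f1 : f <= 4 * (a ^+ 2 * (q + q ^+ 2)).
  have g1 := ler_wpM2l a20 S1; have g2 := ler_wpM2l a20 S2q.
  have g3 := mulr_ge0 a20 q0; have g4 := mulr_ge0 a20 (sqr_ge0 q).
  by rewrite /f; lra.
have f2 : a ^+ 2 * (q + q ^+ 2) <= a * (q + q ^+ 2).
  by rewrite ler_wpM2r ?addr_ge0 ?sqr_ge0// expr2 ler_piMr// ltW.
have f3 : a * (L - 2 * S) <= a * (q + q ^+ 2) by rewrite ler_wpM2l// ltW.
have f4 : 0 <= a * (q + q ^+ 2) by rewrite mulr_ge0 ?(ltW a0)// addr_ge0// sqr_ge0.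
have := ler_normB (2 * a ^+ 2 * (L - N * mu)) f.
rewrite (ger0_norm f0) normrM (ger0_norm a220).
by move=> g; lra.
Qed.

(* D <= 1 settles the cases M > 2 L, where 4 (L - M)^2 / M^2 >= 1, and
   sqrt (7 C a) Q / L >= 1; otherwise 7 C a (Q / L)^2 <= sqrt (7 C a) Q / L. *)
Lemma truncated_error_le (C a M L Q D : R) :
    1 <= C -> 0 < a -> 7 * C * a <= 1 -> 0 < M -> 0 < L -> 0 <= Q -> D <= 1 ->
    D <= C * (2 * a ^+ 2 * `|L - M| + 7 * a * (Q / L + (Q / L) ^+ 2)) ->
  D <= 2 * C * (a + a ^+ 3 * (L - M) ^+ 2) + 4 / M ^+ 2 * (L - M) ^+ 2 +
    4 * Num.sqrt (7 * C * a) / M * Q.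
Proof.
move=> C1 a0 Ca M0 L0 Q0 D1 D2.
set z := L - M in D2 *; set q := Q / L in D2.
have q0 : 0 <= q by rewrite divr_ge0// ltW.
have al0 : 0 <= 7 * C * a by rewrite mulr_ge0 ?(ltW a0)//; lra.
set b := Num.sqrt _.
have bb : b ^+ 2 = 7 * C * a by rewrite sqr_sqrtr.
have b0 : 0 <= b by exact: sqrtr_ge0.
have b1 : b <= 1 by rewrite -[leRHS]sqrtr1 ler_wsqrtr.
have z20 := sqr_ge0 z.
have a30 : 0 <= a ^+ 3 by rewrite exprn_ge0 ?(ltW a0).
have B3 : 0 <= 4 / M ^+ 2 * z ^+ 2 by rewrite mulr_ge0 ?divr_ge0 ?sqr_ge0.
have B4 : 0 <= 4 * b / M * Q.
  by rewrite mulr_ge0// divr_ge0 ?(ltW M0)// mulr_ge0.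
have B2 : 0 <= 2 * C * (a + a ^+ 3 * z ^+ 2).
  by have az0 := mulr_ge0 a30 z20; rewrite mulr_ge0//; lra.
have [LM|LM] := leP M (2 * L); last first.
  suff : 1 <= 4 / M ^+ 2 * z ^+ 2 by lra.
  rewrite mulrAC ler_pdivlMr ?exprn_gt0// mul1r.
  by rewrite /z; nra.
(* From here on L >= M / 2, so the random denominator is traded for M / 2 and [Q] enters
   linearly. *)
have qb : 2 * (b * q) <= 4 * b / M * Q.
  have -> : 4 * b / M * Q = 2 * (b * (Q * (2 / M))) by ring.
  rewrite ler_wpM2l// ler_wpM2l// /q ler_wpM2l//.
  by rewrite -[leRHS]invf_div lef_pV2 ?posrE ?divr_gt0//; lra.
have [bq|bq] := leP 1 (b * q); first by lra.
have g1 : 7 * C * a * (q + q ^+ 2) <= 2 * (b * q).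
  have -> : 7 * C * a * (q + q ^+ 2) = b * (b * q) + (b * q) * (b * q) by rewrite -bb; ring.
  have bq0 : 0 <= b * q by rewrite mulr_ge0.
  have h1 : b * (b * q) <= b * q by rewrite ler_piMl.
  have h2 : (b * q) * (b * q) <= b * q by rewrite ler_piMl// ltW.
  by lra.
(* By a |z| <= 1 + (a |z|)^2, the second moment of z suffices. *)
have g2 : a ^+ 2 * `|z| <= a + a ^+ 3 * z ^+ 2.
  have -> : a + a ^+ 3 * z ^+ 2 = a * (1 + (a * `|z|) ^+ 2).
    by rewrite exprMn real_normK ?num_real//; ring.
  rewrite expr2 -mulrA ler_wpM2l ?(ltW a0)//.
  by have := sqr_ge0 (a * `|z| - 1); have := sqr_ge0 (a * `|z|); nra.
have g3 : C * (a ^+ 2 * `|z|) <= C * (a + a ^+ 3 * z ^+ 2) by rewrite ler_wpM2l//; lra.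
lra.
Qed.

End real_inequalities.

Section edge_sums.
Context {R : realType} (n : nat).
Implicit Types w : 'I_n -> R.

Lemma sqr_sum_vertex_pair w :
  (\sum_(i < n) w i) ^+ 2 =
  \sum_(i < n) w i ^+ 2 + 2 * \sum_(e : vertex_pair n) w (val e).1 * w (val e).2.
Proof.
have -> : \sum_(e : vertex_pair n) w (val e).1 * w (val e).2 =
    \sum_(i < n) \sum_(j < n | (i < j)%N) w i * w j.
  rewrite pair_big_dep /=.
  rewrite (reindex_omap (val : vertex_pair n -> _) insub) /=; last first.
    by move=> e e12; rewrite insubT.
  by apply: eq_bigl => e; rewrite valK eqxx (valP e).
rewrite expr2 big_distrlr /= [2]mulr2n mulrDl mul1r.
rewrite [X in _ + (_ + X)](exchange_big_dep predT) //=.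
rewrite -!big_split /=; apply: eq_bigr => i _.
rewrite (bigD1 i)//= expr2; congr (_ + _).
rewrite (bigID (fun j : 'I_n => (i < j)%N)) /=; congr (_ + _).
  by apply: eq_bigl => j; rewrite -(inj_eq val_inj) /=; case: ltngtP.
apply: eq_big => [j|j _]; last by rewrite mulrC.
by rewrite -(inj_eq val_inj) /=; case: ltngtP.
Qed.

Variable w : 'I_n -> R.
Hypothesis w0 : forall i, 0 < w i.
Hypothesis n0 : (0 < n)%N.

Let L := \sum_(i < n) w i.
Let Q := \sum_(i < n) w i ^+ 2.
Let p (e : vertex_pair n) :=
  w (val e).1 * w (val e).2 / (L + w (val e).1 * w (val e).2).

Let L0 : 0 < L.
Proof.
rewrite /L (bigD1 (Ordinal n0))//= ltr_pwDl// sumr_ge0// => i _.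
exact: ltW.
Qed.

Let ww0 (e : vertex_pair n) : 0 < w (val e).1 * w (val e).2.
Proof. by rewrite mulr_gt0. Qed.

Lemma edge_prob01 e : 0 <= p e <= 1.
Proof.
have Le0 : 0 < L + w (val e).1 * w (val e).2 by rewrite addr_gt0.
by rewrite /p divr_ge0 ?(ltW (ww0 e)) ?(ltW Le0)//= ler_pdivrMr// mul1r lerDr ltW.
Qed.

Let p_le e : p e <= w (val e).1 * w (val e).2 / L.
Proof.
by rewrite /p ler_wpM2l ?(ltW (ww0 e))// lef_pV2 ?posrE ?addr_gt0// lerDl ltW.
Qed.

Let p_ge e : w (val e).1 * w (val e).2 / L - p e <=
  (w (val e).1 ^+ 2 * w (val e).2 ^+ 2) / L ^+ 2.
Proof.
have Le0 : 0 < L + w (val e).1 * w (val e).2 by rewrite addr_gt0.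
rewrite /p -exprMn; have := ww0 e; set u := w _ * w _ in Le0 *; move=> u0.
have -> : u / L - u / (L + u) = u ^+ 2 / L / (L + u) by field; rewrite !gt_eqF.
have -> : u ^+ 2 / L ^+ 2 = u ^+ 2 / L / L by field; rewrite gt_eqF.
rewrite ler_wpM2l ?divr_ge0 ?sqr_ge0 ?(ltW L0)//.
by rewrite lef_pV2 ?posrE// lerDl ltW.
Qed.

Let sum_ww : 2 * \sum_(e : vertex_pair n) (w (val e).1 * w (val e).2 / L) = L - Q / L.
Proof.
rewrite -mulr_suml mulrA; have := sqr_sum_vertex_pair w; rewrite -/L -/Q => H.
apply: (mulIf (lt0r_neq0 L0)).
by rewrite mulrBl !divfK ?gt_eqF// -expr2 H; ring.
Qed.

(** The formula for the square of a sum, applied to the squared weights, gives Q^2 minus the sum of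
    the fourth powers. *)
Let sum_ww2 : 2 * \sum_(e : vertex_pair n)
  (w (val e).1 ^+ 2 * w (val e).2 ^+ 2 / L ^+ 2) <= (Q / L) ^+ 2.
Proof.
rewrite -mulr_suml mulrA exprMn exprVn ler_wpM2r ?invr_ge0 ?sqr_ge0//.
rewrite (sqr_sum_vertex_pair (fun i => w i ^+ 2)) lerDr sumr_ge0// => i _.
exact: sqr_ge0.
Qed.

Lemma sum_edge_prob_le : 2 * \sum_(e : vertex_pair n) p e <= L.
Proof.
apply: (@le_trans _ _ (L - Q / L)).
  by rewrite -sum_ww ler_wpM2l// ler_sum.
by rewrite lerBlDr lerDl divr_ge0 ?(ltW L0)// sumr_ge0// => i _; exact: sqr_ge0.
Qed.

Lemma sum_edge_prob_ge :
  L - 2 * \sum_(e : vertex_pair n) p e <= Q / L + (Q / L) ^+ 2.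
Proof.
have : \sum_(e : vertex_pair n) (w (val e).1 * w (val e).2 / L - p e) <=
    \sum_(e : vertex_pair n) (w (val e).1 ^+ 2 * w (val e).2 ^+ 2 / L ^+ 2).
  by rewrite ler_sum.
by rewrite sumrB; have := sum_ww; have := sum_ww2; lra.
Qed.

Lemma sum_sqr_edge_prob_le : 2 * \sum_(e : vertex_pair n) p e ^+ 2 <= (Q / L) ^+ 2.
Proof.
apply: le_trans sum_ww2; rewrite ler_wpM2l// ler_sum// => e _.
have /andP[pe0 _] := edge_prob01 e.
rewrite -exprMn -expr_div_n; apply: lerXn2r; [| |exact: p_le] => //.
by rewrite nnegrE divr_ge0 ?(ltW (ww0 e)) ?(ltW L0).
Qed.

(** The edge exchange at fixed weights. On the right, the ratio Q / L has disappeared: all terms are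
    affine in [L], in the square of [L - n mu] and in [Q], so they can be integrated exactly. *)
Lemma poisson_binomial_edge_prob (m k s a mu v : R) :
    0 < k -> k <= s -> 0 < a -> 0 < mu -> 0 < v ->
    n%:R * a ^+ 2 * v = 1 -> 7 * heat_const k * a <= 1 ->
  `|poisson_binomial [seq p e | e <- index_enum (vertex_pair n)]
      (fun j => heat m s (a * (2 * j%:R - n%:R * mu))) -
    heat m (s + 2 * mu / v) (a * (L - n%:R * mu))| <=
  12 * heat_const k * a ^+ 3 * L + 2 * heat_const k * (a + a ^+ 3 * (L - n%:R * mu) ^+ 2) +
  4 / (n%:R * mu) ^+ 2 * (L - n%:R * mu) ^+ 2 + 4 * Num.sqrt (7 * heat_const k * a) / (n%:R * mu) * Q.
Proof.
move=> k0 ks a0 mu0 v0 nav Ca; set C := heat_const k in Ca *; set z := L - _.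
have C1 : 1 <= C := heat_const_ge1 k0.
have a1 : 7 * a <= 1.
  by apply: le_trans Ca; rewrite -/C ler_wpM2r ?(ltW a0)//; lra.
have a01 : 0 < a <= 1 by rewrite a0 /=; lra.
set ps := [seq _ | _ <- _].
have sum_ps (f : R -> R) : \sum_(x <- ps) f x = \sum_(e : vertex_pair n) f (p e).
  by rewrite big_map.
set S := \sum_(e : vertex_pair n) p e; set S2 := \sum_(e : vertex_pair n) p e ^+ 2.
have S_le := sum_edge_prob_le; have S_ge := sum_edge_prob_ge.
have S2_le := sum_sqr_edge_prob_le; rewrite -/S -/S2 in S_le S_ge S2_le.
have S0 : 0 <= S by rewrite sumr_ge0// => e _; have /andP[] := edge_prob01 e.
have S20 : 0 <= S2 by rewrite sumr_ge0// => e _; exact: sqr_ge0.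
have Q0 : 0 <= Q by rewrite sumr_ge0// => e _; exact: sqr_ge0.
have c01 : 0 <= 2 * a <= 1.
  apply/andP; split; lra.
have ps01 : {in ps, forall x, 0 <= x <= 1}.
  by move=> x /mapP[e _ ->]; exact: edge_prob01.
(* The conditional center: a (2 j - n mu) = y + 2 a (j - S), so one edge moves the argument by c = 2
   a. *)
set y := a * (2 * S - n%:R * mu).
have H1 := poisson_binomial_heat m k0 y ks c01 ps01.
rewrite (sum_ps id) (sum_ps (fun x => x * (1 - x))) -/S in H1.
have VE : \sum_(e : vertex_pair n) p e * (1 - p e) = S - S2.
  by rewrite /S /S2 -sumrB; apply: eq_bigr => e _; ring.
rewrite VE in H1.
rewrite (@eq_poisson_binomial _ _ _
  (fun j => heat m s (y + 2 * a * (j%:R - S)))); last first.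
  by move=> j; congr heat; rewrite /y; ring.
set PB := poisson_binomial _ _ in H1 *.
set V := (2 * a) ^+ 2 * (S - S2) in H1.
have V0 : 0 <= V.
  rewrite mulr_ge0 ?sqr_ge0// -VE sumr_ge0// => e _.
  by have /andP[? ?] := edge_prob01 e; rewrite mulr_ge0// subr_ge0.
have t0 : 0 <= 2 * mu / v by rewrite divr_ge0 ?(ltW v0)//; lra.
have H2 : `|heat m (s + V) y - heat m (s + 2 * mu / v) (a * z)| <=
  C * (`|V - 2 * mu / v| + `|y - a * z|).
  have := @heat_lip R m k k0 (s + V) (s + 2 * mu / v) y (a * z).
  have -> : s + V - (s + 2 * mu / v) = V - 2 * mu / v by ring.
  by apply; rewrite (le_trans ks)// lerDl.
have H3 : `|heat m (s + V) y - heat m (s + 2 * mu / v) (a * z)| <= 1.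
  by rewrite dist_unit_interval ?heat_ge0 ?heat_le1.
have nmu0 : 0 < n%:R * mu by rewrite mulr_gt0// ltr0n.
have q0 : 0 <= Q / L by rewrite divr_ge0 ?(ltW L0).
have L2S : 0 <= L - 2 * S <= Q / L + (Q / L) ^+ 2 by rewrite S_ge andbT subr_ge0.
have H4 := edge_error_le mu a01 v0 nav q0 L2S S20 S2_le.
have C0 : 0 <= C := le_trans ler01 C1.
have H5 := truncated_error_le C1 a0 Ca nmu0 L0 Q0 H3 (le_trans H2 (ler_wpM2l C0 H4)).
have H6 : `|PB - heat m (s + V) y| <= 12 * C * a ^+ 3 * L.
  apply: le_trans H1 _.
  (* The 12 is 3 * 4: the exchange costs 3 C (2 a)^3 S, and (2 a)^3 S = 4 a^3 (2 S) with 2 S <=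
     L. *)
  have -> : 12 * C * a ^+ 3 * L = 3 * C * (4 * a ^+ 3 * L) by ring.
  apply: ler_wpM2l; first by rewrite mulr_ge0.
  have -> : (2 * a) ^+ 3 * S = 4 * a ^+ 3 * (2 * S) by ring.
  by rewrite ler_wpM2l// mulr_ge0// exprn_ge0// ltW.
apply: le_trans (ler_distD (heat m (s + V) y) _ _) _.
by apply: le_trans (lerD H6 H5) _; rewrite !addrA.
Qed.

End edge_sums.

(** * Convergence in distribution *)

Section heat_test_functions.
Context d (T : measurableType d) (R : realType) (P : probability T R).

(** With t = sqrt(r^2 + 1), the argument (x + K r) / t differs from x by at most |K| r from the
    shift plus |x| r from the scaling, as 1 - 1 / t <= r. The Lipschitz constant 16 turns 2 e into
    32 e. *)
Let heat_gauss_cdf_dist (x K r e : R) : `|K| * r <= e -> `|x| * r <= e -> 0 < r -> r <= 1 ->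
  `|heat (x + K * r) (r ^+ 2 + 1) 0 - gauss_cdf x| <= 32 * e.
Proof.
move=> Kr xr r0 r1.
have r2 : 0 < r ^+ 2 by rewrite exprn_gt0.
rewrite /heat subr0; set t := Num.sqrt _.
have tt : t ^+ 2 = r ^+ 2 + 1 by rewrite sqr_sqrtr//; lra.
have t0 : 0 <= t by exact: sqrtr_ge0.
have t1 : 1 <= t by nra.
have tV1 : t^-1 <= 1 by rewrite invf_le1//; lra.
have tV0 : 0 < t^-1 by rewrite invr_gt0; lra.
have tV2 : 1 - t^-1 <= r.
  have -> : 1 - t^-1 = (t - 1) * t^-1 by field; lra.
  have : t <= 1 + r by nra.
  by nra.
apply: le_trans (gauss_cdf_lip _ _) _.
have -> : (x + K * r) / t - x = K * r * t^-1 - x * (1 - t^-1) by ring.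
have e1 : `|K * r * t^-1| <= e.
  rewrite !normrM (gtr0_norm r0) (gtr0_norm tV0).
  by apply: le_trans Kr; rewrite ler_piMr// mulr_ge0// ltW.
have e2 : `|x * (1 - t^-1)| <= e.
  rewrite normrM (@ger0_norm _ (1 - t^-1)); last by lra.
  by apply: le_trans xr; rewrite ler_wpM2l.
by have := ler_normB (K * r * t^-1) (x * (1 - t^-1)); lra.
Qed.

(** Here [i] is the probability under study and [g] its limit; [ip] and [im] are the means of the
    heat functions shifted up and down, [hp] and [hm] their limits, [gp] and [gm] the values of
    [gauss_cdf] at K and -K. *)
Let sandwich (e g hp hm ip im i gp gm : R) :
  `|hp - ip| <= e / 4 -> `|hm - im| <= e / 4 ->
  `|hp - g| <= 32 * (e / 128) -> `|hm - g| <= 32 * (e / 128) ->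
  gm <= e / 4 -> 1 - gp <= e / 4 -> i <= ip + (1 - gp) -> im - gm <= i ->
  `|g - i| <= e.
Proof.
rewrite !ler_norml => /andP[u1 u2] /andP[v1 v2] /andP[u3 u4] /andP[v3 v4] *.
by apply/andP; split; lra.
Qed.

(** At time r^2 the heat function moves from 0 to 1 over a width of order r. Shifted up by K r it is
    at least [gauss_cdf K] on the half-line up to x, and shifted down by K r it is at most
    [gauss_cdf (- K)] beyond x, so the indicator lies between the two up to Gaussian tails. *)
Lemma cvg_in_distribution_heat (X : nat -> T -> R) :
    (forall n, measurable_fun setT (X n)) ->
    (forall m k, 0 < k ->
       \int[P]_w heat m k (X n w) @[n --> \oo] --> heat m (k + 1) 0) ->
  cvg_in_distribution P X (normal_prob 0 1).
Proof.
move=> mX H; split => // x _.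
have mE n : measurable (X n @^-1` [set` `]-oo, x]]).
  by rewrite -[_ @^-1` _]setTI; apply: mX.
suff : (fine (P (X n @^-1` [set` `]-oo, x]]))) @[n --> \oo] --> gauss_cdf x.
  move=> L.
  have : P (X n @^-1` [set` `]-oo, x]]) @[n --> \oo] --> (gauss_cdf x)%:E.
    apply/fine_cvgP; split; last exact: L.
    by apply: nearW => n; rewrite fin_num_measure.
  rewrite EFin_gauss_cdf; exact.
apply/cvgrPdist_le => e e0.
have e4 : 0 < e / 4 by lra.
have [K K0 [K1 K2]] := gauss_cdf_tails e4.
have e128 : 0 < e / 128 by lra.
pose M := `|x| + K + 1.
have x0 := normr_ge0 x.
have M1 : 1 <= M by rewrite /M; lra.
(* The width is such that K r and |x| r are both at most e / 128, which [heat_gauss_cdf_dist] turns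
   into e / 4. *)
pose r := Num.min 1 (e / 128 / M).
have M0 : 0 < M by lra.
have r0 : 0 < r by rewrite lt_min ltr01 divr_gt0.
have r1 : r <= 1 by rewrite ge_min lexx.
have rM : M * r <= e / 128 by rewrite mulrC -ler_pdivlMr// ge_min lexx orbT.
have xr : `|x| * r <= e / 128 by apply: le_trans rM; rewrite ler_wpM2r ?(ltW r0)// /M; lra.
have Kr : K * r <= e / 128 by apply: le_trans rM; rewrite ler_wpM2r ?(ltW r0)// /M; lra.
have k0 : 0 < r ^+ 2 by rewrite exprn_gt0.
have U := heat_gauss_cdf_dist (x := x) (K := K) (r := r) (e := e / 128).
have D := heat_gauss_cdf_dist (x := x) (K := - K) (r := r) (e := e / 128).
rewrite ger0_norm ?(ltW K0)// in U; rewrite normrN ger0_norm ?(ltW K0)// in D.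
have {}U := U Kr xr r0 r1; have {}D := D Kr xr r0 r1.
have /cvgrPdist_le HU := H (x + K * r) _ k0.
have /cvgrPdist_le HD := H (x + - K * r) _ k0.
have {}HU := HU _ e4; have {}HD := HD _ e4.
apply: filterS2 HU HD => n hU hD.
have sr : Num.sqrt (r ^+ 2) = r by rewrite sqrtr_sqr ger0_norm// ltW.
have rheat m : rintegrable P (fun w => heat m (r ^+ 2) (X n w)).
  apply: (@bounded_rintegrable _ _ _ _ _ 1).
    exact: measurableT_comp (measurable_heat m _) (mX n).
  by move=> w; rewrite ger0_norm ?heat_ge0 ?heat_le1.
set A := X n @^-1` _.
have mA : measurable A by exact: mE.
have rA : rintegrable P (\1_A).
  apply: (@bounded_rintegrable _ _ _ _ _ 1) => // w.
  by rewrite indicE; case: (_ \in _); rewrite ?normr1 ?normr0.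
rewrite -(Rintegral_indic P mA).
have up : \int[P]_w (\1_A w : R) <=
    \int[P]_w heat (x + K * r) (r ^+ 2) (X n w) + (1 - gauss_cdf K).
  rewrite -[X in _ + X](Rintegral_cstT P) -RintegralD//; [|exact: rheat|exact: rintegrable_cst].
  apply: le_Rintegral => //; first by apply: rintegrableD => //; exact: rintegrable_cst.
  move=> w _; rewrite indicE; have [/set_mem|_] := boolP (w \in A); last first.
    by rewrite addr_ge0 ?heat_ge0// subr_ge0 gauss_cdf_le1.
  rewrite /A /= in_itv /= => Xx; rewrite addrCA lerDl subr_ge0.
  apply: gauss_cdf_homo; rewrite sr ler_pdivlMr// lerBrDr addrC.
  by rewrite lerD2r.
have lo : \int[P]_w heat (x + - K * r) (r ^+ 2) (X n w) - gauss_cdf (- K) <=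
    \int[P]_w (\1_A w : R).
  rewrite -[X in _ - X](Rintegral_cstT P) -RintegralB//; [|exact: rheat|exact: rintegrable_cst].
  apply: le_Rintegral => //; first by apply: rintegrableB => //; exact: rintegrable_cst.
  move=> w _; rewrite indicE; have [_|/negP] := boolP (w \in A).
    by rewrite lerBlDr (le_trans (heat_le1 _ _ _))// lerDl gauss_cdf_ge0.
  rewrite inE /A /= in_itv /= => /negP; rewrite -ltNge => Xx; rewrite subr_le0.
  apply: gauss_cdf_homo; rewrite sr ler_pdivrMr// lerBlDr addrC.
  by rewrite lerD2l ltW.
exact: sandwich hU hD U D K1 K2 up lo.
Qed.

End heat_test_functions.

(** * The number of edges *)

Lemma near_cvg_dist (R : realType) (u e : nat -> R) (l : R) :
  (\forall n \near \oo, `|u n - l| <= e n) -> e n @[n --> \oo] --> 0 ->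
  u n @[n --> \oo] --> l.
Proof.
move=> ue e0; apply/cvgrPdist_le => d d0.
move/cvgrPdist_le : e0 => /(_ _ d0) e0.
apply: filterS2 ue e0 => n un en; rewrite distrC (le_trans un)//.
by move: en; rewrite sub0r normrN => /(le_trans (ler_norm _)).
Qed.

Section edge_count_clt.
Context (d : measure_display) (T : measurableType d) (R : realType)
    (P : probability T R)
    (W : nat -> {RV P >-> R})
    (I : forall n : nat, vertex_pair n -> {RV P >-> bool}).
Hypothesis W_iid : iid W.
Hypothesis W_pos : {ae P, forall w, 0 < W 0%N w}.
Hypothesis I_grg :
  forall n : nat, (0 < n)%N -> is_generalized_random_graph W (@I n).
Hypothesis rW2 : rintegrable P (fun w => W 0%N w ^+ 2).

Let mu : R := \int[P]_w W 0%N w.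
Let var : R := \int[P]_w (W 0%N w - mu) ^+ 2.
Let M2 : R := \int[P]_w W 0%N w ^+ 2.
Let v : R := 2 * mu + var.

Let rW : rintegrable P (W 0%N).
Proof. exact: sqr_rintegrable rW2. Qed.

Lemma ae_weights_pos : {ae P, forall w, forall i, 0 < W i w}.
Proof.
apply: ae_foralln => i.
have m0 j : measurable (W j @^-1` `]-oo, 0]) by exact: measurable_funPTI.
have E0 : P (W 0%N @^-1` `]-oo, 0]) = 0%E.
  move: W_pos => [N [mN PN sN]].
  apply/eqP; rewrite -measure_le0 -PN le_measure ?inE// => w /= Ww.
  by apply: sN => /=; apply/negP; rewrite -leNgt; move: Ww; rewrite in_itv.
exists (W i @^-1` `]-oo, 0]); split => //.
  by rewrite -E0; exact: (W_iid.2 i 0%N).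
by move=> w /= /negP; rewrite -leNgt in_itv.
Qed.

(** Since W > 0 almost surely, mu is the mean of |W|, and mu = 0 would force W = 0 almost surely. *)
Lemma mean_pos : 0 < mu.
Proof.
have mu_abs : mu = \int[P]_w `|W 0%N w|.
  rewrite /mu /Rintegral; congr fine; apply: ae_eq_integral => //.
  - exact/measurable_EFinP.
  - by apply/measurable_EFinP; exact: measurableT_comp.
  - by apply: filterS W_pos => w w0 _; rewrite gtr0_norm.
rewrite lt_def; apply/andP; split; last first.
  by rewrite mu_abs; apply: Rintegral_ge0 => w _.
apply/negP => /eqP mu0.
have I0 : (\int[P]_w `|(W 0%N w)%:E| = 0)%E.
  have := rintegrable_norm rW => /(integrable_fin_num measurableT) /fineK <-.
  by rewrite -[fine _]/(\int[P]_w `|W 0%N w|) -mu_abs mu0.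
have mW : measurable_fun setT (EFin \o W 0%N) by exact/measurable_EFinP.
have W0 := (ae_eq_integral_abs P measurableT mW).1 I0.
have : {ae P, forall w : T, False}.
  apply: filterS2 W_pos W0 => w w0 /(_ Logic.I) [] we; move: w0.
  by rewrite we ltxx.
move=> [N [mN PN sN]].
have /eqP : P setT = 0%E.
  apply/eqP; rewrite -measure_le0 -PN le_measure ?inE// => w _.
  by apply: sN.
by rewrite (_ : P _ = 1%E) ?onee_eq0//; exact: probability_setT.
Qed.

Let var0 : 0 <= var.
Proof. by apply: Rintegral_ge0 => w _; exact: sqr_ge0. Qed.

Let v0 : 0 < v. Proof. by have := mean_pos; have := var0; rewrite /v; lra. Qed.

Let edge n (e : vertex_pair n) : set T := I e @^-1` [set true].

Let medge n (e : vertex_pair n) : measurable (edge e).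
Proof. exact: measurable_funPTI. Qed.

Let edge_countE n w :
  edge_count (@I n) w = (\sum_(e : vertex_pair n) (w \in edge e))%N.
Proof.
apply: eq_bigr => e _; congr nat_of_bool.
by apply/idP/idP; rewrite inE.
Qed.

Lemma measurable_edge_count n :
  measurable_fun setT (fun w => (edge_count (@I n) w)%:R : R).
Proof.
have -> : (fun w => (edge_count (@I n) w)%:R : R) =
    fun w => \sum_(e : vertex_pair n) \1_(edge e) w.
  by apply/funext => w; rewrite edge_countE natr_sum.
by apply: measurable_sum => e; exact: measurable_indic.
Qed.

Lemma Rintegral_edge_count n (F : nat -> R) (M : R) : (0 < n)%N ->
  (forall j, `|F j| <= M) ->
  rintegrable P (fun w => poisson_binomial
      [seq edge_prob W e w | e <- index_enum (vertex_pair n)] F) /\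
  \int[P]_w F (edge_count (@I n) w) =
  \int[P]_w poisson_binomial
    [seq edge_prob W e w | e <- index_enum (vertex_pair n)] F.
Proof.
move=> n0 FM; have [cp ci] := I_grg n0.
have GT : weight_sigma_algebra W n setT.
  exact: (@measurableT _ (g_sigma_algebraType _)).
have [] := @Rintegral_cond_independent_count _ _ _ P _ _ (fun e => edge e)
  (fun e => edge_prob W e) GT (fun e => medge e) cp ci F M FM
  (index_enum (vertex_pair n)) finset.set0 (index_enum_uniq _).
  by move=> e _; rewrite inE.
move=> _ r2 e; split.
  move: r2; congr (is_true (_.-integrable _ _)).
  by apply/funext => w /=; rewrite big_set0 mul1r.
move: e; congr (_ = _); apply: eq_Rintegral => w _; rewrite big_set0 mul1r//.
by rewrite edge_countE.
Qed.

Let weight_sums n :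
  [/\ rintegrable P (fun w => total_weight W n w),
      \int[P]_w total_weight W n w = n%:R * mu,
      rintegrable P (fun w => (total_weight W n w - n%:R * mu) ^+ 2) &
      \int[P]_w (total_weight W n w - n%:R * mu) ^+ 2 = n%:R * var].
Proof.
have rWi i := (@iid_rintegrable _ _ _ _ _ W_iid id i (@measurable_id _ _ _) rW).1.
have EWi i : \int[P]_w W i w = mu :=
  (@iid_rintegrable _ _ _ _ _ W_iid id i (@measurable_id _ _ _) rW).2.
have zE w : total_weight W n w - n%:R * mu = \sum_(i < n) (W i.+1 w - mu).
  by rewrite sumrB sumr_const card_ord mulr_natl.
have [r2 E2] := variance_sum W_iid rW2 n.
split.
- by apply: rintegrable_sum => i; exact: rWi.
- rewrite Rintegral_sum; last by move=> i; exact: rWi.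
  under eq_bigr do rewrite EWi.
  by rewrite sumr_const card_ord mulr_natl.
- by under eq_fun do rewrite zE; exact: r2.
- by under eq_Rintegral do rewrite zE; exact: E2.
Qed.

Let sqr_weight_sum n :
  rintegrable P (fun w => \sum_(i < n) W i.+1 w ^+ 2) /\
  \int[P]_w (\sum_(i < n) W i.+1 w ^+ 2) = n%:R * M2.
Proof.
have mf : measurable_fun setT (fun y : R => y ^+ 2) by exact: measurable_funX.
have H i := @iid_rintegrable _ _ _ _ _ W_iid (fun y => y ^+ 2) i mf rW2.
split; first by apply: rintegrable_sum => i; exact: (H _).1.
rewrite Rintegral_sum; last by move=> i; exact: (H _).1.
rewrite (eq_bigr (fun=> M2)); last by move=> i _; exact: (H _).2.
by rewrite sumr_const card_ord mulr_natl.
Qed.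

Let scale n : R := (Num.sqrt (n%:R * v))^-1.

Let scaleE n : (0 < n)%N -> n%:R * scale n ^+ 2 * v = 1.
Proof.
move=> n0; have nv : 0 < n%:R * v by rewrite mulr_gt0// ltr0n.
rewrite /scale exprVn sqr_sqrtr ?(ltW nv)// mulrAC divff//.
by rewrite gt_eqF.
Qed.

Let scale_cvg : scale n @[n --> \oo] --> 0.
Proof.
apply/cvgrPdist_le => e e0; near=> n.
have n1 : (e ^+ 2 * v)^-1 <= n%:R by near: n; exact: nbhs_infty_ger.
have ev0 : 0 < e ^+ 2 * v by rewrite mulr_gt0// exprn_gt0.
have nv0 : 0 < n%:R * v by rewrite mulr_gt0// (lt_le_trans _ n1)// invr_gt0.
rewrite sub0r normrN ger0_norm ?invr_ge0 ?sqrtr_ge0//.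
rewrite /scale invf_ple ?posrE ?sqrtr_gt0//.
rewrite -[leLHS]ger0_norm ?invr_ge0 ?(ltW e0)// -sqrtr_sqr ler_wsqrtr//.
rewrite -ler_pdivrMr// exprVn -invfM//.
Unshelve. all: by end_near. Qed.

Variables (m k : R).
Hypothesis k0 : 0 < k.

Let C := heat_const k.

(** This is [lindeberg_error] without its factor a^2, which is compensated by the number n = 1 /
    (a^2 v) of exchanges. *)
Let truncated_variance (a : R) : R :=
  \int[P]_w ((W 0%N w - mu) ^+ 2 * Num.min 1 `|a * (W 0%N w - mu)|).

(** The integrated bounds of both exchanges with n eliminated through n a^2 v = 1; as a function of
    [a] alone, each term visibly tends to 0 with [a], except the one in [truncated_variance],
    treated separately. *)
Let error (a : R) : R :=
  12 * C * mu / v * a + 2 * C * (1 + var / v) * a + 4 * var * v / mu ^+ 2 * a ^+ 2 +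
  4 * M2 / mu * Num.sqrt (7 * C * a) +
  (C / v * truncated_variance a + C * var ^+ 2 / v * a ^+ 2).

Let truncated_sqr_le (a y : R) : `|y ^+ 2 * Num.min 1 `|a * y| | <= y ^+ 2.
Proof.
have m0 : 0 <= Num.min 1 `|a * y| by rewrite le_min ler01 normr_ge0.
by rewrite normrM (ger0_norm (sqr_ge0 y)) (ger0_norm m0) ler_piMr ?sqr_ge0// ge_min lexx.
Qed.

Let measurable_truncated_sqr (a : R) : measurable_fun setT
  (fun w => (W 0%N w - mu) ^+ 2 * Num.min 1 `|a * (W 0%N w - mu)|).
Proof.
apply: measurable_funM; first by apply: measurable_funX; exact: measurable_funB.
apply: measurable_minr => //; apply: measurableT_comp => //.
by apply: measurable_funM => //; exact: measurable_funB.
Qed.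

Let heat_edge_count_dist n : (0 < n)%N -> 7 * C * scale n <= 1 ->
  `|\int[P]_w heat m k
      ((2 * (edge_count (@I n) w)%:R - n%:R * mu) / Num.sqrt (n%:R * v)) -
    heat m (k + 1) 0| <= error (scale n).
Proof.
move=> n0 Ca; have v1 := v0; have mu0 := mean_pos.
have nR0 : 0 < n%:R :> R by rewrite ltr0n.
have nav := scaleE n0.
have a0 : 0 < scale n by rewrite invr_gt0 sqrtr_gt0 mulr_gt0.
set a := scale n in Ca nav a0 *.
pose F (j : nat) := heat m k (a * (2 * j%:R - n%:R * mu)).
have FM j : `|F j| <= 1 by rewrite ger0_norm ?heat_ge0 ?heat_le1.
have [rPB EPB] := Rintegral_edge_count n0 FM.
have -> : \int[P]_w heat m k
      ((2 * (edge_count (@I n) w)%:R - n%:R * mu) / Num.sqrt (n%:R * v)) =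
    \int[P]_w F (edge_count (@I n) w).
  by apply: eq_Rintegral => w _; rewrite /F mulrC.
rewrite EPB.
have [rL EL rz Ez] := weight_sums n; have [rQ EQ] := sqr_weight_sum n.
have C0 : 0 < C := lt_le_trans ltr01 (heat_const_ge1 k0).
have nmu0 : 0 < n%:R * mu by rewrite mulr_gt0.
pose c1 := 12 * C * a ^+ 3; pose c2 := 2 * C * a.
pose c3 := 2 * C * a ^+ 3 + 4 / (n%:R * mu) ^+ 2.
pose c4 := 4 * Num.sqrt (7 * C * a) / (n%:R * mu).
pose b w := 12 * C * a ^+ 3 * total_weight W n w +
  2 * C * (a + a ^+ 3 * (total_weight W n w - n%:R * mu) ^+ 2) +
  4 / (n%:R * mu) ^+ 2 * (total_weight W n w - n%:R * mu) ^+ 2 +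
  4 * Num.sqrt (7 * C * a) / (n%:R * mu) * \sum_(i < n) W i.+1 w ^+ 2.
have bE w : b w = (c1 * total_weight W n w + c2) +
   (c3 * (total_weight W n w - n%:R * mu) ^+ 2 + c4 * \sum_(i < n) W i.+1 w ^+ 2).
  by rewrite /b /c1 /c2 /c3 /c4; ring.
have r1 := rintegrableZ c1 rL; have r2 := rintegrable_cst P c2.
have r3 := rintegrableZ c3 rz; have r4 := rintegrableZ c4 rQ.
have r12 := rintegrableD r1 r2; have r34 := rintegrableD r3 r4.
have rb : rintegrable P b.
  by have -> := funext bE; exact: rintegrableD r12 r34.
have Eb : \int[P]_w b w = (c1 * (n%:R * mu) + c2) + (c3 * (n%:R * var) + c4 * (n%:R * M2)).
  under eq_Rintegral do rewrite bE.
  rewrite RintegralD; [|by []|exact: r12|exact: r34].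
  rewrite RintegralD; [|by []|exact: r1|exact: r2].
  rewrite RintegralD; [|by []|exact: r3|exact: r4].
  rewrite Rintegral_cstT; congr (_ + _ + (_ + _)).
  - by rewrite -[in RHS]EL; apply: Rintegral_scale.
  - by rewrite -[in RHS]Ez; apply: Rintegral_scale.
  - by rewrite -[in RHS]EQ; apply: Rintegral_scale.
have [rS _] := variance_sum W_iid rW2 n.
pose S w := a * \sum_(i < n) (W i.+1 w - mu).
pose s := k + 2 * mu / v.
have ks : k <= s by rewrite lerDl divr_ge0 ?(ltW v1)// mulr_ge0// ltW.
have mS : measurable_fun setT S.
  by apply: measurable_funM => //; apply: measurable_sum => i; exact: measurable_funB.
have rS' : rintegrable P (fun w => heat m s (S w)).
  apply: (@bounded_rintegrable _ _ _ _ _ 1).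
    exact: measurableT_comp (measurable_heat m s) mS.
  by move=> w; rewrite ger0_norm ?heat_ge0 ?heat_le1.
have L1 := lindeberg_sum W_iid rW2 m k0 n a ks.
rewrite -/mu -/var -/C in L1.
have sE : s + n%:R * (a ^+ 2 * var) = k + 1.
  have -> : n%:R * (a ^+ 2 * var) = (n%:R * a ^+ 2 * v) * var / v by field; rewrite gt_eqF.
  by rewrite nav /s /v mul1r; field; rewrite gt_eqF.
rewrite sE in L1.
have L2 : `|\int[P]_w poisson_binomial
      [seq edge_prob W e w | e <- index_enum (vertex_pair n)] F -
    \int[P]_w heat m s (S w)| <= \int[P]_w b w.
  apply: ae_Rintegral_dist => //.
  apply: filterS (ae_weights_pos) => w Ww.
  have -> : S w = a * (total_weight W n w - n%:R * mu).
    by rewrite /S sumrB sumr_const card_ord mulr_natl.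
  exact: (@poisson_binomial_edge_prob R n (fun i => W i.+1 w) (fun i => Ww i.+1)
    n0 m k k a mu v k0 (lexx k) a0 mu0 v1 nav Ca).
have LE : lindeberg_error W a = a ^+ 2 * truncated_variance a.
  rewrite /lindeberg_error -/mu; apply: Rintegral_scale.
    by move=> w; rewrite exprMn mulrA.
  have [r _] := iid_centered2 W_iid rW2 0.
  apply: le_rintegrable r; first exact: measurable_truncated_sqr.
  by move=> w; exact: truncated_sqr_le.
rewrite Eb in L2; rewrite LE in L1.
apply: le_trans (ler_distD (\int[P]_w heat m s (S w)) _ _) _.
apply: le_trans (lerD L2 L1) _.
rewrite /error le_eqVlt; apply/predU1P; left.
have av : a ^+ 2 * v != 0 by rewrite gt_eqF// mulr_gt0// exprn_gt0.
have nE : n%:R = (a ^+ 2 * v)^-1 by apply: (mulIf av); rewrite mulVf// mulrA nav.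
rewrite /c1 /c2 /c3 /c4 nE; field.
by rewrite !gt_eqF.
Qed.

(** Lindeberg's condition from a second moment: with Y the centered weight, the integrand is at most
    |Y|^3 a pointwise, which tends to 0, and is dominated by Y^2. *)
Let truncated_variance_cvg : truncated_variance (scale n) @[n --> \oo] --> 0.
Proof.
have [r2 _] := iid_centered2 W_iid rW2 0.
apply: Rintegral_dominated_cvg0 r2.
- by move=> n; exact: measurable_truncated_sqr.
- move=> w; apply: (@near_cvg_dist _ _ (fun n => `|W 0%N w - mu| ^+ 3 * scale n)).
    apply: nearW => n; rewrite subr0.
    have s0 : 0 <= scale n by rewrite invr_ge0 sqrtr_ge0.
    have -> : `|W 0%N w - mu| ^+ 3 * scale n =
        `|W 0%N w - mu| ^+ 2 * (`|W 0%N w - mu| * scale n) by ring.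
    rewrite normrM normrX ler_wpM2l ?exprn_ge0//.
    rewrite ger0_norm ?le_min ?ler01 ?normr_ge0// ge_min normrM (ger0_norm s0) mulrC.
    by rewrite lexx orbT.
  rewrite -[X in _ --> X](mulr0 (`|W 0%N w - mu| ^+ 3)).
  by apply: cvgM; [exact: cvg_cst|exact: scale_cvg].
- by move=> n w; exact: truncated_sqr_le.
Qed.

Let error_cvg : error (scale n) @[n --> \oo] --> 0.
Proof.
have s2 : scale n ^+ 2 @[n --> \oo] --> (0 : R).
  by rewrite -[X in _ --> X](mulr0 (0 : R)); apply: cvgM; exact: scale_cvg.
have cc (c : R) (u : nat -> R) : u n @[n --> \oo] --> (0 : R) ->
    c * u n @[n --> \oo] --> (0 : R).
  by move=> u0; rewrite -[X in _ --> X](mulr0 c); apply: cvgM => //; exact: cvg_cst.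
have sq : Num.sqrt (7 * C * scale n) @[n --> \oo] --> (0 : R).
  have c0 := cc (7 * C) _ scale_cvg.
  have := cvg_comp _ _ c0 (@sqrt_continuous R 0).
  by rewrite sqrtr0; exact.
have dd (u w : nat -> R) : u n @[n --> \oo] --> (0 : R) -> w n @[n --> \oo] --> (0 : R) ->
    u n + w n @[n --> \oo] --> (0 : R).
  by move=> u0 w0; rewrite -[X in _ --> X](addr0 (0 : R)); apply: cvgD.
apply: (dd _ _); last by apply: (dd _ _); apply: (cc _ _) => //; exact: truncated_variance_cvg.
apply: (dd _ _); last exact: (cc _ _).
apply: (dd _ _); last exact: (cc _ _).
by apply: (dd _ _); apply: (cc _ _); exact: scale_cvg.
Qed.

Lemma cvg_heat_edge_count :
  \int[P]_w heat m k
      ((2 * (edge_count (@I n) w)%:R - n%:R * mu) / Num.sqrt (n%:R * v))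
    @[n --> \oo] --> heat m (k + 1) 0.
Proof.
have C1 := heat_const_ge1 k0.
apply: near_cvg_dist error_cvg.
have C7' : 0 < 7 * C by rewrite mulr_gt0// (lt_le_trans ltr01).
have C7 : 0 < (7 * C)^-1 by rewrite invr_gt0.
move/cvgrPdist_le : scale_cvg => /(_ _ C7) H.
near=> n; apply: heat_edge_count_dist; first by near: n; exists 1%N.
have : `|0 - scale n| <= (7 * C)^-1 by near: n; exact: H.
rewrite sub0r normrN => /(le_trans (ler_norm _)).
by rewrite -div1r ler_pdivlMr// mulrC.
Unshelve. all: by end_near. Qed.

End edge_count_clt.

Unset Implicit Arguments.

Theorem theorem1 (d : measure_display) (T : measurableType d) (R : realType)
    (P : probability T R)
    (W : nat -> {RV P >-> R})
    (I : forall n : nat, vertex_pair n -> {RV P >-> bool}) :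
  iid W ->
  {ae P, forall w, 0 < W 0%N w} ->
  (forall n : nat, (0 < n)%N -> is_generalized_random_graph W (I n)) ->
  ('E_P[fun w => (W 0%N w ^+ 2)%R] < +oo)%E ->
  let EW := fine 'E_P[W 0%N] in
  let VarW := fine 'V_P[W 0%N] in
  cvg_in_distribution P
    (fun n w => (2 * (edge_count (I n) w)%:R - n%:R * EW) /
                Num.sqrt (n%:R * (2 * EW + VarW)))
    (normal_prob 0 1).
Proof.
move=> W_iid W_pos I_grg EW2 EW VarW.
have rW2 : rintegrable P (fun w => W 0%N w ^+ 2).
  apply/integrableP; split; first by apply/measurable_EFinP; exact: measurable_funX.
  (* For the nonnegative variable W^2, a finite expectation is integrability. *)
  move: EW2; rewrite unlock; apply: le_lt_trans.
  rewrite le_eqVlt; apply/predU1P; left; apply: eq_integral => w _ /=.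
  by rewrite ger0_norm ?sqr_ge0.
have EWE : EW = \int[P]_w W 0%N w by rewrite /EW unlock.
have VarWE : VarW = \int[P]_w (W 0%N w - EW) ^+ 2.
  rewrite /VarW /variance unlock /EW; rewrite unlock.
  by rewrite /Rintegral; congr fine; apply: eq_integral => w _; rewrite expr2.
apply: cvg_in_distribution_heat.
  move=> n; apply: measurable_funM => //; apply: measurable_funB => //.
  by apply: measurable_funM => //; exact: measurable_edge_count.
move=> m k k0; rewrite VarWE EWE.
exact: cvg_heat_edge_count.
Qed.
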